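(* Let $\Omega=[-\pi,\pi]^d$ be the $2\pi$-periodic $d$-dimensional torus in physical dimensions $d\le 3$, and let $m\ge 1$ be an integer. Consider the matrix-valued Allen-Cahn equation for $U:[0,\infty)\times\Omega\to\mathbb R^{m\times m}$, $$\partial_tU=\Delta U+U-UU^{\mathrm T}U,\quad (t,x)\in(0,\infty)\times\Omega;\qquad U|_{t=0}=U^0,$$ where $U^0:\Omega\to\mathbb R^{m\times m}$ is the initial data. Set $\mathcal S_{\mathcal L}(t)=e^{t\Delta}$ (applied entry-wise), and for $A\in\mathbb R^{m\times m}$ set $$\mathcal S_{\mathcal N}(t)A=\big((e^{2t}-1)AA^{\mathrm T}+\mathrm I\big)^{-\frac12}e^tA,$$ applied pointwise in $x$ to functions $\Omega\to\mathbb R^{m\times m}$. For a splitting time step $\tau>0$, define the Strang-splitting iterates, for $n\ge0$, by $$U^{n+1}=\mathcal S_{\mathcal L}(\tau/2)\,\mathcal S_{\mathcal N}(\tau)\,\mathcal S_{\mathcal L}(\tau/2)\,U^n.$$ Then the following hold. (1) (Maximum principle) For any $\tau>0$ and any $n\ge0$, $$\big\|\,\|U^{n+1}\|_F\,\big\|_{L^\infty_x}\le\max\{\sqrt m,\ \big\|\,\|U^n\|_F\,\big\|_{L^\infty_x}\}.$$ It follows that $\sup_{n\ge1}\|\,\|U^n\|_F\,\|_{L^\infty_x}\le\max\{\sqrt m,\ \|\,\|U^0\|_F\,\|_{L^\infty_x}\}$. In particular, if $\|\,\|U^0\|_F\,\|_{L^\infty_x}\le\sqrt m$, then $\sup_{n\ge1}\|\,\|U^n\|_F\,\|_{L^\infty_x}\le\sqrt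 m$. (2) (Modified energy dissipation for small time step) Assume $\|\,\|U^0\|_F\,\|_{L^\infty_x}\le\sqrt m$. If $\tau>0$ satisfies $$m\,e^\tau(e^{2\tau}-1)\le0.43,$$ then $$\widetilde E(\tilde U^{n+1})\le\widetilde E(\tilde U^n)\quad\text{for all }n\ge0,$$ where $\tilde U^n=\mathcal S_{\mathcal L}(\tau/2)U^n$, $$\widetilde E(U)=\int_\Omega\Big(\frac1{2\tau}\big\langle(e^{-\tau\Delta}-1)U,U\big\rangle_F+\langle G(U),\mathrm I\rangle_F\Big)\,dx,$$ $$G(U)=\frac1{2\tau}UU^{\mathrm T}-\frac{e^\tau}{\tau(e^{2\tau}-1)}\Big(\big(\mathrm I+(e^{2\tau}-1)UU^{\mathrm T}\big)^{\frac12}-\mathrm I\Big).$$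
   Context: $\langle A,B\rangle_F=\mathrm{Tr}(A^{\mathrm T}B)=\sum_{i,j}A_{ij}B_{ij}$ is the Frobenius inner product on $\mathbb R^{m\times m}$, $\|A\|_F=\langle A,A\rangle_F^{1/2}$ is the Frobenius norm, and $\mathrm I$ is the $m\times m$ identity matrix. Powers $\pm\frac12$ of symmetric positive-definite matrices are the usual symmetric positive-definite ones. The Laplacian is applied entry-wise with periodic boundary conditions. For $t>0$, $e^{t\Delta}$ is the heat semigroup on the torus (convolution with the scalar periodic heat kernel, i.e. the Fourier multiplier $e^{-t|k|^2}$, $k\in\mathbb Z^d$), and $e^{-\tau\Delta}$ is the Fourier multiplier $e^{\tau|k|^2}$. $\|\,\|V\|_F\,\|_{L^\infty_x}$ is the $L^\infty$ norm over $x\in\Omega$ of the function $x\mapsto\|V(x)\|_F$. *)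

(* Defs.v *)
From HB Require Import structures.
From mathcomp Require Import all_boot all_order all_algebra.
From mathcomp Require Import all_classical all_reals all_analysis ess_sup_inf.

Set Implicit Arguments.
Unset Strict Implicit.
Unset Printing Implicit Defensive.

Import Order.TTheory GRing.Theory Num.Theory.
Import numFieldNormedType.Exports.

Local Open Scope classical_set_scope.
Local Open Scope ring_scope.

Notation Rd R d := (d.-tuple (measurableTypeR R)).

(* Lebesgue measure on R^d (absent from the library): the Dirac mass on the
   one-point space R^0, and the image of lebesgue_measure \x mu under
   (x, p) |-> x :: p in dimension d.+1. *)
Section LebesgueCons.
Context (R : realType) (d : nat).

Definition Rd_cons (p : measurableTypeR R * Rd R d) : Rd R d.+1 :=
  [the d.+1.-tuple _ of p.1 :: p.2].

Lemma measurable_Rd_cons : measurable_fun [set: _] Rd_cons.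
Proof. exact: measurable_cons. Qed.

HB.instance Definition _ := isMeasurableFun.Build _ _ _ _ Rd_cons
  measurable_Rd_cons.

Variable mu : {sigma_finite_measure set (Rd R d) -> \bar R}.

Definition lebesgue_cons : set (Rd R d.+1) -> \bar R :=
  pushforward (@lebesgue_measure R \x mu)%E Rd_cons.

Let lebesgue_cons0 : lebesgue_cons set0 = 0%E.
Proof. by rewrite /lebesgue_cons /pushforward preimage_set0 measure0. Qed.

Let lebesgue_cons_ge0 A : (0 <= lebesgue_cons A)%E.
Proof. exact: measure_ge0. Qed.

Let lebesgue_cons_sigma_additive : semi_sigma_additive lebesgue_cons.
Proof.
exact: (@measure_semi_sigma_additive _ _ _
  (pushforward (@lebesgue_measure R \x mu)%E Rd_cons)).
Qed.

HB.instance Definition _ := isMeasure.Build _ _ _ lebesgue_cons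
  lebesgue_cons0 lebesgue_cons_ge0 lebesgue_cons_sigma_additive.

Let lebesgue_cons_sigma_finite : sigma_finite setT lebesgue_cons.
Proof.
have /sigma_finiteP[F [TF ndF Foo]] := sigma_finiteT (@lebesgue_measure R).
have /sigma_finiteP[G [TG ndG Goo]] := sigma_finiteT mu.
pose uncons (q : Rd R d.+1) : measurableTypeR R * Rd R d :=
  (thead q, [tuple of behead q]).
have muncons : measurable_fun [set: Rd R d.+1] uncons.
  apply/measurable_fun_pairP; split => /=.
    exact: measurable_tnth.
  exact: measurable_behead.
exists (fun i => uncons @^-1` (F i `*` G i)).
  apply/esym/seteqP; split => // q _.
  have [i _ Fi] : (\bigcup_i F i) (uncons q).1 by rewrite -TF.
  have [j _ Gj] : (\bigcup_i G i) (uncons q).2 by rewrite -TG.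
  exists (maxn i j) => //; split.
    by move: Fi; exact/subsetPset/ndF/leq_maxl.
  by move: Gj; exact/subsetPset/ndG/leq_maxr.
move=> i; have [mF Fi] := Foo i; have [mG Gi] := Goo i; split.
  rewrite -[X in measurable X]setTI; apply: muncons => //.
  exact: measurableX.
rewrite /lebesgue_cons /pushforward (_ : _ @^-1` _ = F i `*` G i).
  by rewrite product_measure1E// lte_mul_pinfty// ge0_fin_numE.
rewrite -comp_preimage (_ : _ \o _ = id) ?preimage_id//.
by apply/funext => -[x p] /=; congr pair; exact: val_inj.
Qed.

HB.instance Definition _ := Measure_isSigmaFinite.Build _ _ _ lebesgue_cons
  lebesgue_cons_sigma_finite.

End LebesgueCons.

Fixpoint lebesgue_Rd (R : realType) (d : nat) :
    {sigma_finite_measure set (Rd R d) -> \bar R} :=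
  if d is d'.+1 then lebesgue_cons (lebesgue_Rd R d') else dirac [tuple].

(* Functions on the torus are represented by functions on R^d; every notion
   below depends only on their values on this fundamental domain. *)
Definition torus (R : realType) (d : nat) : set (Rd R d) :=
  [set x | forall i, - pi <= tnth x i <= pi].

Arguments torus : clear implicits.

Lemma measurable_torus (R : realType) (d : nat) : measurable (torus R d).
Proof.
rewrite (_ : torus R d = \bigcap_(i in [set: 'I_d])
    ((fun x : Rd R d => tnth x i) @^-1` [set` `[- pi, pi]])).
  apply: fin_bigcap_measurable => // i _.
  rewrite -[X in measurable X]setTI.
  by apply: (@measurable_tnth _ (measurableTypeR R)) => //; exact: measurable_itv.
apply/seteqP; split => x tx i; first by move=> _; rewrite /= in_itv; exact: tx.
by have /= := tx i Logic.I; rewrite in_itv.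
Qed.

Section Matrices.
Context (R : realType) (m : nat).
Implicit Types A B : 'M[R]_m.

Definition frob_inner A B : R := \tr (A^T *m B).

Definition frob_norm A : R := Num.sqrt (frob_inner A A).

Definition spd A : Prop :=
  A^T = A /\ forall v : 'cV[R]_m, v != 0 -> 0 < (v^T *m A *m v) 0 0.

(* The symmetric positive-definite square root of A; 0 if there is none. *)
Definition sqrtmx A : 'M[R]_m := xget 0 [set B | spd B /\ B *m B = A].

Definition nonlinear_flow (t : R) A : 'M[R]_m :=
  invmx (sqrtmx ((expR (2 * t) - 1) *: (A *m A^T) + 1%:M)) *m (expR t *: A).

Definition G (tau : R) A : 'M[R]_m :=
  (2 * tau)^-1 *: (A *m A^T)
  - (expR tau / (tau * (expR (2 * tau) - 1))) *:
      (sqrtmx (1%:M + (expR (2 * tau) - 1) *: (A *m A^T)) - 1%:M).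

End Matrices.

Section Torus.
Context (R : realType) (d m : nat).
Implicit Types (k : {ffun 'I_d -> int}) (x : Rd R d)
  (U : Rd R d -> 'M[R]_m) (p : R -> R) (N : nat).

Definition freq_dot k x : R := \sum_i (k i)%:~R * tnth x i.

Definition freq_sqnorm k : R := \sum_i (k i)%:~R ^+ 2.

(* Real and (up to sign) imaginary parts of the entries of the Fourier
   coefficient (2 pi)^-d \int_torus U(y) e^{-i k.y} dy. *)
Definition fourier_cos U k : 'M[R]_m := \matrix_(i, j)
  ((2 * pi) ^- d
   * \int[lebesgue_Rd R d]_(y in torus R d) (U y i j * cos (freq_dot k y))).

Definition fourier_sin U k : 'M[R]_m := \matrix_(i, j)
  ((2 * pi) ^- d
   * \int[lebesgue_Rd R d]_(y in torus R d) (U y i j * sin (freq_dot k y))).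

Definition box_freq N (k : {ffun 'I_d -> 'I_(N.*2.+1)}) : {ffun 'I_d -> int} :=
  [ffun i => (k i)%:Z - N%:Z].

(* Partial sum over the frequencies with |k_i| <= N of the Fourier multiplier
   with symbol p(|k|^2) applied entry-wise to U. Since U is real and the symbol
   is real and even, p(|k|^2) e^{i k.x} \hat U(k) may be replaced by its real
   part: the imaginary parts of the terms k and - k cancel. *)
Definition multiplier_partial p U N x : 'M[R]_m :=
  \sum_(k : {ffun 'I_d -> 'I_(N.*2.+1)})
    p (freq_sqnorm (box_freq k)) *:
      (cos (freq_dot (box_freq k) x) *: fourier_cos U (box_freq k)
       + sin (freq_dot (box_freq k) x) *: fourier_sin U (box_freq k)).

Definition multiplier p U x : 'M[R]_m :=
  \matrix_(i, j) limn (fun N => multiplier_partial p U N x i j).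

Definition heat (t : R) U : Rd R d -> 'M[R]_m :=
  multiplier (fun s => expR (- (t * s))) U.

Definition Linfty_norm U : \bar R :=
  ess_sup (mrestr (lebesgue_Rd R d) (@measurable_torus R d))
    (fun x => (frob_norm (U x))%:E).

Definition strang_step (tau : R) U : Rd R d -> 'M[R]_m :=
  heat (tau / 2) (fun x => nonlinear_flow tau (heat (tau / 2) U x)).

Definition strang (tau : R) U (n : nat) : Rd R d -> 'M[R]_m :=
  iter n (strang_step tau) U.

(* (e^{- tau Laplacian} - 1) U need not be a function (already for the
   iterate n = 0), so its integral against U is the pairing of a distribution
   with U, i.e. the limit of the integrals over the partial Fourier sums. These
   are nondecreasing in N, as e^{tau |k|^2} - 1 >= 0, so that the limit exists
   in \bar R. *)
Definition modified_energy (tau : R) U : \bar R :=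
  limn (fun N => \int[lebesgue_Rd R d]_(x in torus R d)
    ((2 * tau)^-1
       * frob_inner (multiplier_partial (fun s => expR (tau * s) - 1) U N x) (U x)
     + frob_inner (G tau (U x)) 1%:M)%:E)%E.

End Torus.

(* Main.v *)
Require Import Defs.
From HB Require Import structures.
From mathcomp Require Import all_boot all_order all_algebra.
From mathcomp Require Import all_classical all_reals all_analysis.
From mathcomp Require Import measurable_realfun complex ring lra zify.

Set Implicit Arguments.
Unset Strict Implicit.
Unset Printing Implicit Defensive.

Import Order.TTheory GRing.Theory Num.Theory.
Import numFieldNormedType.Exports.

Local Open Scope classical_set_scope.
Local Open Scope ring_scope.

(** The nonlinear flow and the heat semigroup both preserve the bounds
    |U|_F <= r with r >= sqrt m, which gives the maximum principle.

    For the heat semigroup, summing the Fourier multiplier over boxes of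
    frequencies makes its kernel a product of one-dimensional theta functions
    (sum_box_prod_theta). A theta function is nonnegative: it is the limit of
    its Fejer means, which are nonnegative because the Gaussian sequence is
    positive definite (sum_theta_partial_ge0). So heat t U is an average of U
    against a probability density, and the bound follows by pairing with heat
    t U x itself (heat_frob_le). For the nonlinear flow, the bound is a trace
    inequality for S = (I + c A A^T)^(1/2) (nonlinear_flow_le). These roots
    exist by the spectral theorem, and depend continuously on A because S >= I
    makes the Sylvester equation for the difference of two roots coercive
    (root_gram_lipschitz); the iterates are therefore measurable.

    For the energy, write V for heat (tau / 2) U^n, W for its image under the
    nonlinear flow and V' for heat (tau / 2) U^(n+1), so that
    V' = e^(tau Laplacian) W. The gradient of A |-> <G(A), I> is (A - W) / tau,
    and the term with the square root is a concave function of A, namely minus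
    a multiple of the nuclear norm of the block row (I, sqrt c A)
    (trace_root_gram_subgradient). Hence
    <G(V'), I> <= <G(V), I> + <V' + V - 2 W, V' - V> / (2 tau)
    pointwise. In the Fourier mode k, where W has lam = e^(tau |k|^2) times the
    coefficient b of V', the quadratic part of the energy compensates this
    term: with a for the coefficient of V, the sum of the two changes is
    - lam |a - b|^2 / (2 tau) (dissipation_mode). Summing over the modes uses
    Parseval's identity only for functions in the range of the heat semigroup,
    where the partial Fourier sums converge boundedly (parseval_heat). *)

(** * Symmetric positive-definite square roots *)

Lemma interpolation_poly (F : fieldType) (f : F -> F) (s : seq F) :
  exists p : {poly F}, {in s, forall x, p.[x] = f x}.
Proof.
elim: s => [|a s [p ps]]; first by exists 0.
have [sa|sa] := boolP (a \in s).
  by exists p => x /[!inE] /predU1P[->|]; exact: ps.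
pose q : {poly F} := \prod_(b <- s) ('X - b%:P).
have qs x : root q x = (x \in s) by rewrite root_prod_XsubC.
(* q vanishes on s, so that adding a multiple of it only moves p.[a]. *)
exists (p + ((f a - p.[a]) / q.[a]) *: q) => x.
rewrite inE hornerD hornerZ => /predU1P[->|xs].
  by rewrite divfK ?subrKC// -[_ != _]/(~~ root q a) qs.
by rewrite (rootP _ : q.[x] = 0) ?qs// mulr0 addr0 ps.
Qed.

Lemma cV_sqnorm_ge0 (R : realType) n (v : 'cV[R]_n) : 0 <= (v^T *m v) 0 0.
Proof. by rewrite mxE sumr_ge0// => i _; rewrite mxE -expr2 sqr_ge0. Qed.

Lemma cV_sqnorm_gt0 (R : realType) n (v : 'cV[R]_n) :
  v != 0 -> 0 < (v^T *m v) 0 0.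
Proof.
move=> /cV0Pn[i vi]; rewrite mxE (bigD1 i)//= ltr_pwDl//.
  by rewrite mxE -expr2 exprn_even_gt0.
by rewrite sumr_ge0// => j _; rewrite mxE -expr2 sqr_ge0.
Qed.

Section spd.
Context {R : realType} {n : nat}.
Implicit Types (A B M S : 'M[R]_n) (v : 'cV[R]_n).

Lemma spd_unitmx A : spd A -> A \in unitmx.
Proof.
move=> [AT Apos]; rewrite -row_free_unit -kermx_eq0; apply: contraT => K0.
have /rowV0Pn[u uK u0] := K0.
have uA : u *m A = 0 by exact/sub_kermxP.
have uT0 : u^T != 0 by rewrite -[0](trmx0 R 1 n) (inj_eq trmx_inj).
by have := Apos _ uT0; rewrite trmxK uA mul0mx mxE ltxx.
Qed.

Lemma spd_eigenvalue_gt0 A (a : R) : spd A -> eigenvalue A a -> 0 < a.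
Proof.
move=> [_ Apos] /eigenvalueP[v vA v0].
have vT0 : v^T != 0 by rewrite -[0](trmx0 R 1 n) (inj_eq trmx_inj).
have := Apos _ vT0; rewrite trmxK vA -scalemxAl mxE.
have vv : 0 <= (v *m v^T) 0 0 by rewrite -{1}[v]trmxK cV_sqnorm_ge0.
by move=> h; rewrite ltNge; apply/negP => a0; move: h; rewrite ltNge mulr_le0_ge0.
Qed.

End spd.

(** The eigenvalues of the hermitian matrix obtained from M are real numbers,
    hence eigenvalues of M itself, and therefore positive. If p is a real
    polynomial interpolating the fourth root at them, then C = p(M) is a real
    symmetric matrix with C^4 = M, so that C^2 is a square root of M; it is
    positive because C is symmetric and invertible. *)
Lemma spd_sqrt_over (R : realType) (K : numClosedFieldType)
    (f : {rmorphism R -> K}) (n : nat) (M : 'M[R]_n.+1) :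
    (forall x, f x \is Num.real) ->
    (forall z : K, z \is Num.real -> exists x, z = f x) ->
  spd M -> exists B, spd B /\ B *m B = M.
Proof.
move=> freal fsurj spdM; have [MT _] := spdM.
pose Mc := map_mx f M; pose P := spectralmx Mc; pose D := spectral_diag Mc.
have Mcherm : Mc \is hermsymmx.
  rewrite is_hermitianmxE expr0 scale1r; apply/eqP/matrixP => i j.
  by rewrite !mxE -[in LHS]MT mxE; apply/esym/CrealP.
have /fin_all_exists[l Dl] : forall i, exists x, D 0 i = f x.
  move=> i; apply: fsurj.
  by have /mxOverP/(_ 0 i) := hermitian_spectral_diag_real Mcherm.
have MPD : Mc = invmx P *m diag_mx D *m P.
  by apply/orthomx_spectralP; exact: hermitian_normalmx.
have Pu : P \in unitmx by exact: spectral_unit.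
have l_gt0 i : 0 < l i.
  apply: (spd_eigenvalue_gt0 spdM).
  rewrite -(eigenvalue_map f) -Dl; apply/eigenvalueP; exists (row i P).
    rewrite -/Mc MPD !mulmxA -row_mul mulmxV// row1.
    by rewrite -rowE -row_mul mul_diag_mx; apply/rowP => j; rewrite !mxE.
  apply/eqP => /(congr1 (mulmx^~ (invmx P))); rewrite mul0mx -row_mul mulmxV//.
  by move=> /rowP/(_ i); rewrite !mxE eqxx => /eqP; rewrite oner_eq0.
pose root4 (x : R) : R := Num.sqrt (Num.sqrt x).
have [p pl] := interpolation_poly root4 [seq l i | i : 'I_n.+1].
pose C : 'M[R]_n.+1 := horner_mx M p.
have CT : C^T = C.
  rewrite /C; elim/poly_ind: (p) => [|q c IH]; first by rewrite rmorph0 trmx0.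
  rewrite rmorphD rmorphM /= horner_mx_X horner_mx_C linearD/= tr_scalar_mx.
  rewrite trmx_mul IH MT; congr (_ + _).
  by rewrite -mulmxE; exact: comm_mx_horner.
have CE : map_mx f C = invmx P *m diag_mx (\row_i f (root4 (l i))) *m P.
  rewrite map_horner_mx -/Mc MPD horner_mx_uconjC// horner_mx_diag.
  congr (_ *m diag_mx _ *m _); apply/rowP => i; rewrite !mxE Dl.
  by rewrite horner_map pl//; apply/mapP; exists i; rewrite ?mem_enum.
have C4 : (C *m C) *m (C *m C) = M.
  apply: (@map_mx_inj _ _ f); rewrite !map_mxM CE -/Mc [RHS]MPD.
  rewrite !mulmxA !(mulmxK Pu) -!mulmxA; congr (_ *m _); rewrite !mulmxA.
  congr (_ *m _); rewrite !mulmx_diag; congr diag_mx; apply/rowP => i.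
  rewrite !mxE -!rmorphM [RHS]Dl; congr (f _).
  have root4_sq : root4 (l i) * root4 (l i) = Num.sqrt (l i).
    by rewrite -expr2 sqr_sqrtr ?sqrtr_ge0.
  by rewrite -mulrA !root4_sq -expr2 sqr_sqrtr// ltW.
exists (C *m C); split=> //; split; first by rewrite trmx_mul CT.
move=> v v0; rewrite !mulmxA -{1}CT -trmx_mul -mulmxA.
apply: cV_sqnorm_gt0; apply: contra v0 => /eqP Cv0.
by rewrite -[v](mulKmx (spd_unitmx spdM)) -C4 -!mulmxA Cv0 !mulmx0.
Qed.

Lemma spd_sqrt_exists (R : realType) (n : nat) (M : 'M[R]_n) :
  spd M -> exists B, spd B /\ B *m B = M.
Proof.
case: n M => [|n] M spdM.
  exists 0; split; last by apply/matrixP => -[].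
  by split=> [|v]; [apply/matrixP => -[]|rewrite [v]flatmx0 eqxx].
apply: (@spd_sqrt_over _ _ (real_complex R)) spdM => [x|z].
  by apply/complex_realP; exists x.
by move=> /complex_realP.
Qed.

(** * Frobenius inner product and traces against positive-definite matrices *)

Section frobenius.
Context {R : realType} {m : nat}.
Implicit Types (A B C S X Y : 'M[R]_m).

Lemma frob_innerE A B : frob_inner A B = \sum_i \sum_j A i j * B i j.
Proof.
rewrite /frob_inner /mxtrace exchange_big/=; apply: eq_bigr => j _.
by rewrite mxE; apply: eq_bigr => i _; rewrite mxE.
Qed.

Lemma frob_innerC A B : frob_inner A B = frob_inner B A.
Proof. by rewrite /frob_inner -mxtrace_tr trmx_mul trmxK. Qed.

Lemma frob_innerDl A B C :
  frob_inner (A + B) C = frob_inner A C + frob_inner B C.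
Proof. by rewrite /frob_inner linearD/= mulmxDl mxtraceD. Qed.

Lemma frob_innerDr A B C :
  frob_inner A (B + C) = frob_inner A B + frob_inner A C.
Proof. by rewrite /frob_inner mulmxDr mxtraceD. Qed.

Lemma frob_innerZl a A B : frob_inner (a *: A) B = a * frob_inner A B.
Proof. by rewrite /frob_inner linearZ/= -scalemxAl mxtraceZ. Qed.

Lemma frob_innerZr a A B : frob_inner A (a *: B) = a * frob_inner A B.
Proof. by rewrite /frob_inner -scalemxAr mxtraceZ. Qed.

Lemma frob_innerNl A B : frob_inner (- A) B = - frob_inner A B.
Proof. by rewrite -scaleN1r frob_innerZl mulN1r. Qed.

Lemma frob_innerNr A B : frob_inner A (- B) = - frob_inner A B.
Proof. by rewrite -scaleN1r frob_innerZr mulN1r. Qed.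

Lemma frob_inner_ge0 A : 0 <= frob_inner A A.
Proof.
rewrite frob_innerE; apply: sumr_ge0 => i _; apply: sumr_ge0 => j _.
by rewrite -expr2 sqr_ge0.
Qed.

Lemma frob_norm_ge0 A : 0 <= frob_norm A.
Proof. exact: sqrtr_ge0. Qed.

Lemma sqr_frob_norm A : frob_norm A ^+ 2 = frob_inner A A.
Proof. by rewrite sqr_sqrtr ?frob_inner_ge0. Qed.

Lemma normr_entry_le_frob A i j : `|A i j| <= frob_norm A.
Proof.
rewrite -(@ler_pXn2r _ 2)// ?nnegrE ?frob_norm_ge0// real_normK ?num_real//.
rewrite sqr_frob_norm frob_innerE (bigD1 i)//= (bigD1 j)//= -expr2 -addrA.
rewrite lerDl addr_ge0// ?sumr_ge0// => k _; first by rewrite -expr2 sqr_ge0.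
by apply: sumr_ge0 => l _; rewrite -expr2 sqr_ge0.
Qed.

Lemma frob_norm_eq0 A : (frob_norm A == 0) = (A == 0).
Proof.
apply/eqP/eqP => [A0|->].
  apply/matrixP => i j; apply/eqP; rewrite mxE -normr_le0 -A0.
  exact: normr_entry_le_frob.
by apply/eqP; rewrite -sqrf_eq0 sqr_frob_norm /frob_inner mulmx0 mxtrace0.
Qed.

Lemma frob_cauchy_schwarz A B : frob_inner A B <= frob_norm A * frob_norm B.
Proof.
have [->|A0] := eqVneq A 0.
  by rewrite /frob_inner trmx0 mul0mx mxtrace0 mulr_ge0 ?frob_norm_ge0.
have [->|B0] := eqVneq B 0.
  by rewrite /frob_inner mulmx0 mxtrace0 mulr_ge0 ?frob_norm_ge0.
have a0 : 0 < frob_norm A by rewrite lt_def frob_norm_eq0 A0 frob_norm_ge0.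
have b0 : 0 < frob_norm B by rewrite lt_def frob_norm_eq0 B0 frob_norm_ge0.
have := frob_inner_ge0 (frob_norm B *: A - frob_norm A *: B).
rewrite !(frob_innerDl, frob_innerDr, frob_innerNl, frob_innerNr,
  frob_innerZl, frob_innerZr) (frob_innerC B A) -!sqr_frob_norm => h.
rewrite -subr_ge0 -(pmulr_rge0 _ (mulr_gt0 a0 b0)).
by rewrite -(pmulr_rge0 _ (ltr0n R 2)); apply: le_trans h _; lra.
Qed.

Lemma trace_spd_ge0 S (p : nat) (X : 'M[R]_(m, p)) :
  spd S -> 0 <= \tr (X^T *m S *m X).
Proof.
move=> [_ Spos]; apply: sumr_ge0 => j _.
have -> : (X^T *m S *m X) j j = ((col j X)^T *m S *m col j X) 0 0.
  by rewrite tr_col -row_mul -!row_mul !mxE; apply: eq_bigr => k _; rewrite !mxE.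
by have [->|/Spos/ltW//] := eqVneq (col j X) 0; rewrite mulmx0 mxE.
Qed.

End frobenius.

(** * The square root of I + c A A^T *)

Section gram.
Context {R : realType} {m : nat}.
Implicit Types (c t : R) (A B S X Y : 'M[R]_m).

Definition shifted_gram c A : 'M[R]_m := c *: (A *m A^T) + 1%:M.

Definition root_gram c A : 'M[R]_m := sqrtmx (shifted_gram c A).

Lemma tr_shifted_gram c A : (shifted_gram c A)^T = shifted_gram c A.
Proof. by rewrite linearD linearZ /= trmx_mul trmxK tr_scalar_mx. Qed.

Lemma spd_shifted_gram c A : 0 <= c -> spd (shifted_gram c A).
Proof.
move=> c0; split=> [|v v0]; first exact: tr_shifted_gram.
rewrite mulmxDr mulmxDl mulmx1 -scalemxAr -scalemxAl mxE.
rewrite ltr_wpDl ?cV_sqnorm_gt0// mxE mulr_ge0//.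
by have := cV_sqnorm_ge0 (A^T *m v); rewrite trmx_mul trmxK !mulmxA.
Qed.

Lemma root_gramP c A : 0 <= c ->
  spd (root_gram c A) /\ root_gram c A *m root_gram c A = shifted_gram c A.
Proof.
move=> c0; rewrite /root_gram /sqrtmx; case: xgetP => [B _ //|nex].
have [B BP] := spd_sqrt_exists (spd_shifted_gram A c0).
by have := nex B; case.
Qed.

Lemma root_gram_spd c A : 0 <= c -> spd (root_gram c A).
Proof. by move=> c0; have [] := root_gramP A c0. Qed.

Lemma root_gram_sq c A : 0 <= c ->
  root_gram c A *m root_gram c A = shifted_gram c A.
Proof. by move=> c0; have [] := root_gramP A c0. Qed.

Lemma tr_root_gram c A : 0 <= c -> (root_gram c A)^T = root_gram c A.
Proof. by move=> c0; have [[]] := root_gramP A c0. Qed.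

Lemma root_gram_unit c A : 0 <= c -> root_gram c A \in unitmx.
Proof. by move=> c0; apply/spd_unitmx/root_gram_spd. Qed.

Lemma frob_shifted_gram c A X : 
  frob_inner X (shifted_gram c A *m X) =
  frob_inner X X + c * frob_inner (A^T *m X) (A^T *m X).
Proof.
rewrite mulmxDl mul1mx frob_innerDr addrC -scalemxAl frob_innerZr.
by rewrite /frob_inner trmx_mul trmxK !mulmxA.
Qed.

(** This is I <= S^2 = I + c A A^T. *)
Lemma frob_le_root_gram_mul c A X : 0 <= c ->
  frob_inner X X <= frob_inner (root_gram c A *m X) (root_gram c A *m X).
Proof.
move=> c0; set S := root_gram c A.
have -> : frob_inner (S *m X) (S *m X) = frob_inner X (shifted_gram c A *m X).
  by rewrite -root_gram_sq// /frob_inner trmx_mul tr_root_gram// !mulmxA.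
by rewrite frob_shifted_gram lerDl mulr_ge0// frob_inner_ge0.
Qed.

(** With X = S U, both sides are traces of U^T S^k U, and S <= S^2 <= S^3
    follows from I <= S^2 by expanding the squares |U - S U|^2 and
    (S U - U)^T S (S U - U). *)
Lemma root_gram_ge1 c A X : 0 <= c ->
  frob_inner X X <= frob_inner X (root_gram c A *m X).
Proof.
move=> c0; set S := root_gram c A; have ST : S^T = S by exact: tr_root_gram.
have [U ->] : exists U, X = S *m U.
  by exists (invmx S *m X); rewrite mulKVmx// root_gram_unit.
have h1 : frob_inner U U <= frob_inner (S *m U) (S *m U).
  exact: frob_le_root_gram_mul.
have h2 := frob_inner_ge0 (U - S *m U).
have h3 := trace_spd_ge0 (S *m U - U) (root_gram_spd A c0).
rewrite -/S in h3.
have E : \tr ((S *m U - U)^T *m S *m (S *m U - U)) =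
  frob_inner (S *m U) (S *m (S *m U)) - frob_inner (S *m U) (S *m U) *+ 2
  + frob_inner U (S *m U).
  rewrite -mulmxA -/(frob_inner (S *m U - U) (S *m (S *m U - U))) mulmxBr.
  rewrite !(frob_innerDl, frob_innerDr, frob_innerNl, frob_innerNr).
  have -> : frob_inner U (S *m (S *m U)) = frob_inner (S *m U) (S *m U).
    by rewrite /frob_inner trmx_mul ST !mulmxA.
  by rewrite mulr2n; ring.
rewrite E in h3.
rewrite !(frob_innerDl, frob_innerDr, frob_innerNl, frob_innerNr) in h2.
rewrite (frob_innerC (S *m U) U) in h2.
by move: h1 h2 h3; rewrite mulr2n; lra.
Qed.

(** The difference D of the two roots solves the Sylvester equation
    S D + D S' = M - M'; testing it with D, and using S, S' >= I, gives
    2 |D|^2 <= <D, M - M'>. *)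
Lemma root_gram_lipschitz c A B : 0 <= c ->
  2 * frob_norm (root_gram c A - root_gram c B) <=
  frob_norm (shifted_gram c A - shifted_gram c B).
Proof.
move=> c0; set S := root_gram c A; set S' := root_gram c B.
set D := S - S'; set N := _ - _.
have DT : D^T = D by rewrite linearB/= !tr_root_gram.
have NE : N = S *m D + D *m S'.
  by rewrite /N -!root_gram_sq// -/S -/S' mulmxBr mulmxBl addrA subrK.
have [->|D0] := eqVneq (frob_norm D) 0; first by rewrite mulr0 frob_norm_ge0.
have Dp : 0 < frob_norm D by rewrite lt_def D0 frob_norm_ge0.
rewrite -(ler_pM2l Dp); apply: le_trans (frob_cauchy_schwarz D N).
rewrite NE frob_innerDr.
have -> : frob_inner D (D *m S') = frob_inner D (S' *m D).
  by rewrite /frob_inner DT [LHS]mxtrace_mulC mulmxA.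
have h1 := @root_gram_ge1 c A D c0; have h2 := @root_gram_ge1 c B D c0.
rewrite -/S in h1; rewrite -/S' in h2.
by rewrite mulrCA -expr2 sqr_frob_norm; lra.
Qed.

(** Since c A A^T = S^2 - I, the squared norm of the flow is
    (1 + c) (m - tr S^-2) / c, while tr S^-2 >= m^2 / tr S^2 by the
    Cauchy-Schwarz inequality, in the tangent form |S^-1 - a S|^2 >= 0 with
    a = m / tr S^2. *)
Lemma nonlinear_flow_le t A (r : R) : 0 < t ->
  Num.sqrt m%:R <= r -> frob_norm A <= r ->
  frob_norm (nonlinear_flow t A) <= r.
Proof.
move=> t0 mr Ar; set c := expR (2 * t) - 1.
have c0 : 0 < c by rewrite subr_gt0 expR_gt1 mulr_gt0.
have c0' := ltW c0.
have r0 : 0 <= r by apply: le_trans mr; exact: sqrtr_ge0.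
have mr2 : m%:R <= r ^+ 2.
  by rewrite -[m%:R]sqr_sqrtr ?ler0n// ler_pXn2r ?nnegrE ?sqrtr_ge0.
have Ar2 : frob_inner A A <= r ^+ 2.
  by rewrite -sqr_frob_norm ler_pXn2r ?nnegrE ?frob_norm_ge0.
rewrite -(@ler_pXn2r _ 2)// ?nnegrE ?frob_norm_ge0// sqr_frob_norm.
set S := root_gram c A.
have -> : nonlinear_flow t A = invmx S *m (expR t *: A) by [].
have ST : (invmx S)^T = invmx S by rewrite trmx_inv tr_root_gram.
have Su : S \in unitmx by exact: root_gram_unit.
have e2 : expR t * expR t = 1 + c.
  by rewrite /c [RHS]addrC subrK -expRD; congr expR; ring.
rewrite -scalemxAr frob_innerZl frob_innerZr mulrA e2.
pose q := frob_inner (invmx S) (invmx S); pose s := frob_inner A A.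
have cF : c * frob_inner (invmx S *m A) (invmx S *m A) = m%:R - q.
  have cAA : c *: (A *m A^T) = S *m S - 1%:M.
    by rewrite root_gram_sq// /shifted_gram addrK.
  rewrite /q /frob_inner mxtrace_mulC trmx_mul ST -mxtraceZ.
  rewrite mulmxA -(mulmxA _ A) scalemxAl scalemxAr cAA.
  by rewrite mulmxBr mulmx1 mulmxA mulVmx// mul1mx mulmxBl mulmxV// linearB/=
    mxtrace1.
have trM : frob_inner S S = m%:R + c * s.
  rewrite /frob_inner tr_root_gram// root_gram_sq// mxtraceD mxtraceZ mxtrace1.
  by rewrite addrC /s /frob_inner mxtrace_mulC.
have SSi : frob_inner (invmx S) S = m%:R.
  by rewrite /frob_inner ST mulVmx// mxtrace1.
have s0 : 0 <= s by exact: frob_inner_ge0.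
pose T := m%:R + c * s; pose F := frob_inner (invmx S *m A) (invmx S *m A).
have F0 : 0 <= F by exact: frob_inner_ge0.
have T0 : 0 <= T by rewrite addr_ge0 ?ler0n// mulr_ge0.
(* T = 0 only happens in dimension 0. *)
have := T0; rewrite le_eqVlt => /predU1P[TE|Tp].
  have mE : m%:R = 0 :> R.
    by apply/eqP; rewrite eq_le ler0n andbT TE lerDl mulr_ge0.
  have q0 : 0 <= q by exact: frob_inner_ge0.
  have : c * F <= 0 by rewrite cF mE; lra.
  rewrite pmulr_rle0// => F_le0; apply: le_trans (sqr_ge0 r).
  by rewrite mulr_ge0_le0// addr_ge0// ltW.
have qT : m%:R ^+ 2 <= q * T.
  have := frob_inner_ge0 (invmx S - (m%:R / T) *: S).
  rewrite !(frob_innerDl, frob_innerDr, frob_innerNl, frob_innerNr,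
    frob_innerZl, frob_innerZr) (frob_innerC S) trM SSi -/q -/T => h.
  have : 0 <= (q - m%:R / T * m%:R - (m%:R / T * m%:R - m%:R / T * (m%:R / T * T))) * T.
    by rewrite mulr_ge0//; lra.
  rewrite divfK ?gt_eqF// !mulrBl; have -> : m%:R / T * m%:R * T = m%:R ^+ 2.
    by rewrite mulrAC divfK ?gt_eqF.
  lra.
have FT : F * T <= m%:R * s.
  by rewrite -(ler_pM2l c0) mulrA cF mulrBl; move: qT; rewrite /T; lra.
have c1 : 0 <= 1 + c by rewrite addr_ge0.
rewrite -(ler_pM2r Tp) -mulrA; apply: (le_trans (ler_wpM2l c1 FT)).
have h1 : m%:R * s <= m%:R * r ^+ 2 by rewrite ler_wpM2l.
have h2 : c * s * m%:R <= c * s * r ^+ 2 by rewrite ler_wpM2l// mulr_ge0.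
by rewrite /T; lra.
Qed.

End gram.

(** * Convexity of A |-> tr (I + c A A^T)^(1/2) *)

Section energy_density.
Context {R : realType} {m : nat}.
Implicit Types (c tau : R) (A B X Z : 'M[R]_m).

Lemma trace_mul_shifted_gram c A Z :
  \tr (Z *m shifted_gram c A) = \tr Z + c * frob_inner A (Z *m A).
Proof.
rewrite mulmxDr mulmx1 mxtraceD addrC -scalemxAr mxtraceZ.
by rewrite /frob_inner -[in RHS]mxtrace_mulC !mulmxA.
Qed.

(** The trace in question is the nuclear norm of the block row (I, sqrt c A),
    which is convex as a supremum of linear forms over co-isometries. The bound
    below is the subgradient inequality that comes from the co-isometry
    S^-1 (I, sqrt c A); it is the expansion of the squared distance, in the
    metric S', of this co-isometry to S'^-1 (I, sqrt c B). *)
Lemma trace_root_gram_subgradient c A B : 0 <= c ->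
  c * frob_inner (invmx (root_gram c A) *m A) (B - A) <=
  \tr (root_gram c B) - \tr (root_gram c A).
Proof.
move=> c0; set S := root_gram c A; set S' := root_gram c B.
have Su : S \in unitmx by exact: root_gram_unit.
have S'u : S' \in unitmx by exact: root_gram_unit.
have ST : (invmx S)^T = invmx S by rewrite trmx_inv tr_root_gram.
have S'T : (invmx S')^T = invmx S' by rewrite trmx_inv tr_root_gram.
have Si1 Z : frob_inner Z 1%:M = \tr Z.
  by rewrite frob_innerC /frob_inner trmx1 mul1mx.
have hX := trace_spd_ge0 (invmx S' - invmx S) (root_gram_spd B c0).
have hY := trace_spd_ge0 (invmx S' *m B - invmx S *m A) (root_gram_spd B c0).
rewrite -/S' -mulmxA -/(frob_inner _ _) mulmxBr mulmxV// in hX.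
rewrite -/S' -mulmxA -/(frob_inner _ _) mulmxBr mulKVmx// in hY.
rewrite !(frob_innerDl, frob_innerDr, frob_innerNl, frob_innerNr) in hX hY.
have e1 : frob_inner (invmx S') (S' *m invmx S) = \tr (invmx S).
  by rewrite /frob_inner S'T mulKmx.
have e2 : frob_inner (invmx S' *m B) (S' *m (invmx S *m A)) =
    frob_inner (invmx S *m A) B.
  by rewrite frob_innerC /frob_inner [in RHS]trmx_mul ST !trmx_mul ST
    tr_root_gram// -!mulmxA mulKVmx.
have e3 : \tr S' = \tr (invmx S') + c * frob_inner (invmx S' *m B) B.
  by rewrite frob_innerC -trace_mul_shifted_gram -root_gram_sq// mulKmx.
have e4 : \tr S' = frob_inner (invmx S) (S' *m invmx S) +
    c * frob_inner (invmx S *m A) (S' *m (invmx S *m A)).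
  have -> : frob_inner (invmx S *m A) (S' *m (invmx S *m A)) =
      frob_inner A (invmx S *m S' *m invmx S *m A).
    by rewrite /frob_inner trmx_mul ST !mulmxA.
  rewrite /frob_inner ST mulmxA -[X in _ = _ + c * X]/(frob_inner _ _).
  rewrite -trace_mul_shifted_gram -root_gram_sq// -/S mulmxA mulmxKV//.
  by rewrite mxtrace_mulC mulKVmx.
have e5 : \tr S = \tr (invmx S) + c * frob_inner (invmx S *m A) A.
  by rewrite frob_innerC -trace_mul_shifted_gram -root_gram_sq// mulKmx.
rewrite frob_innerDr frob_innerNr e5.
rewrite e1 !Si1 in hX; rewrite e2 in hY.
have := addr_ge0 hX (mulr_ge0 c0 hY); lra.
Qed.

Lemma frob_inner_G tau A : frob_inner (G tau A) 1%:M =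
  (2 * tau)^-1 * frob_inner A A
  - expR tau / (tau * (expR (2 * tau) - 1)) *
      (\tr (root_gram (expR (2 * tau) - 1) A) - m%:R).
Proof.
rewrite frob_innerC /frob_inner trmx1 mul1mx /G mxtraceD raddfN/= !mxtraceZ.
rewrite raddfB/= mxtrace1 mxtrace_mulC; congr (_ - _ * (\tr _ - _)).
by rewrite /root_gram /shifted_gram addrC.
Qed.

(** The gradient of the density at A is (A - W) / tau, where W is the image of
    A under the nonlinear flow; the square root part is concave, so that the
    quadratic part alone contributes to the second order term. *)
Lemma frob_inner_G_le tau A B : 0 < tau ->
  frob_inner (G tau B) 1%:M <= frob_inner (G tau A) 1%:M +
    (2 * tau)^-1 * frob_inner (B + A - 2 *: nonlinear_flow tau A) (B - A).
Proof.
move=> tau0; rewrite !frob_inner_G; set c := expR (2 * tau) - 1.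
have c0 : 0 < c by rewrite subr_gt0 expR_gt1 mulr_gt0.
pose k := expR tau / (tau * c).
have k0 : 0 <= k by rewrite divr_ge0 ?expR_ge0// mulr_ge0 ?ltW.
have := ler_wpM2l k0 (trace_root_gram_subgradient A B (ltW c0)).
have -> : nonlinear_flow tau A = expR tau *: (invmx (root_gram c A) *m A).
  by rewrite /nonlinear_flow -/c -scalemxAr.
rewrite mulrA [k * c](_ : _ = expR tau / tau); last first.
  by rewrite /k; field; rewrite !gt_eqF.
rewrite -/k; move: (invmx _ *m A) => W.
rewrite !(frob_innerDl, frob_innerDr, frob_innerNl, frob_innerNr,
  frob_innerZl, frob_innerZr) (frob_innerC A B).
have -> : expR tau / tau = (2 * tau)^-1 * (2 * expR tau).
  by field; rewrite gt_eqF.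
lra.
Qed.

Lemma trace_root_gram_bound c A : 0 <= c ->
  0 <= \tr (root_gram c A) <= m%:R + c * frob_inner A A.
Proof.
move=> c0; set S := root_gram c A; apply/andP; split.
  have := trace_spd_ge0 1%:M (root_gram_spd A c0).
  by rewrite trmx1 mul1mx mulmx1.
have := frob_inner_ge0 (S - 1%:M).
rewrite !(frob_innerDl, frob_innerDr, frob_innerNl, frob_innerNr).
rewrite (frob_innerC S) /frob_inner tr_root_gram// root_gram_sq// trmx1 !mul1mx.
rewrite mxtrace1 mxtraceD mxtraceZ mxtrace1 [\tr (A *m A^T)]mxtrace_mulC => h.
have h2 : 0 <= c * \tr (A^T *m A) by rewrite mulr_ge0// frob_inner_ge0.
by have := ler0n R m; lra.
Qed.

End energy_density.

(** * Measurability of continuous functions of matrix-valued functions *)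

Lemma cvg_sumr (R : realType) (I : Type) (r : seq I) (T : Type)
    (F : set_system T) (FF : Filter F) (f : I -> T -> R) (l : I -> R) :
  (forall i, f i x @[x --> F] --> l i) ->
  \sum_(i <- r) f i x @[x --> F] --> \sum_(i <- r) l i.
Proof. by move=> fl; apply: cvg_big => // x; exact: add_continuous. Qed.

Section mxcvg.
Context {R : realType} {m : nat}.
Implicit Types (a b : nat -> 'M[R]_m) (A B : 'M[R]_m).

(** Sequences suffice: measurability is only preserved by countable limits. *)
Definition mxcvg a A := forall i j, a n i j @[n --> \oo] --> A i j.

Lemma mxcvgD a b A B :
  mxcvg a A -> mxcvg b B -> mxcvg (fun n => a n + b n) (A + B).
Proof.
move=> aA bB i j; rewrite mxE; under eq_fun do rewrite mxE.
exact: cvgD.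
Qed.

Lemma mxcvgZ (k : R) a A : mxcvg a A -> mxcvg (fun n => k *: a n) (k *: A).
Proof.
move=> aA i j; rewrite mxE; under eq_fun do rewrite mxE.
by apply: cvgM => //; exact: cvg_cst.
Qed.

Lemma mxcvg_tr a A : mxcvg a A -> mxcvg (fun n => (a n)^T) A^T.
Proof. by move=> aA i j; rewrite mxE; under eq_fun do rewrite mxE; exact: aA. Qed.

Lemma mxcvg_mul a b A B :
  mxcvg a A -> mxcvg b B -> mxcvg (fun n => a n *m b n) (A *m B).
Proof.
move=> aA bB i j; rewrite mxE; under eq_fun do rewrite mxE.
by apply: cvg_sumr => k; apply: cvgM.
Qed.

Lemma mxcvg_cst A : mxcvg (fun=> A) A.
Proof. by move=> i j; exact: cvg_cst. Qed.

Lemma mxcvg_trace a A : mxcvg a A -> \tr (a n) @[n --> \oo] --> \tr A.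
Proof. by move=> aA; apply: cvg_sumr => i; exact: aA. Qed.

Lemma mxcvg_frob a A : mxcvg a A <-> frob_norm (a n - A) @[n --> \oo] --> 0.
Proof.
split=> [aA|aA i j].
  have aA0 : mxcvg (fun n => a n - A) 0.
    move=> i j; rewrite mxE; under eq_fun do rewrite !mxE.
    by apply/subr_cvg0; exact: aA.
  rewrite -[0]sqrtr0; apply: continuous_cvg; first exact: sqrt_continuous.
  have := mxcvg_trace (mxcvg_mul (mxcvg_tr aA0) aA0).
  by rewrite mulmx0 mxtrace0.
apply/subr_cvg0; apply: norm_cvg0.
apply: (@squeeze_cvgr _ _ _ _ (cst 0) (fun n => frob_norm (a n - A))) => //.
  apply: nearW => n; rewrite normr_ge0/=.
  by have := normr_entry_le_frob (a n - A) i j; rewrite !mxE.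
exact: cvg_cst.
Qed.

Lemma mxcvg_shifted_gram c a A : 
  mxcvg a A -> mxcvg (fun n => shifted_gram c (a n)) (shifted_gram c A).
Proof.
move=> aA; rewrite /shifted_gram; apply: mxcvgD; last exact: mxcvg_cst.
by apply: mxcvgZ; apply: mxcvg_mul => //; exact: mxcvg_tr.
Qed.

Lemma mxcvg_root_gram c a A : 0 <= c ->
  mxcvg a A -> mxcvg (fun n => root_gram c (a n)) (root_gram c A).
Proof.
move=> c0 aA; apply/mxcvg_frob.
have /mxcvg_frob := @mxcvg_shifted_gram c _ _ aA.
apply: squeeze_cvgr; [|exact: cvg_cst]; apply: nearW => n.
rewrite frob_norm_ge0/=; apply: le_trans (root_gram_lipschitz _ _ c0).
by rewrite ler_peMl ?frob_norm_ge0// ler1n.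
Qed.

(** Apply S_n, which does not decrease norms, to S_n^-1 - S^-1; the result
    I - S_n S^-1 tends to 0 by continuity of the root. *)
Lemma mxcvg_inv_root_gram c a A : 0 <= c -> mxcvg a A ->
  mxcvg (fun n => invmx (root_gram c (a n))) (invmx (root_gram c A)).
Proof.
move=> c0 aA; apply/mxcvg_frob.
have /mxcvg_frob := mxcvg_mul (mxcvg_root_gram c0 aA)
  (@mxcvg_cst (invmx (root_gram c A))).
rewrite mulmxV ?root_gram_unit//.
apply: squeeze_cvgr; [|exact: cvg_cst]; apply: nearW => n.
rewrite frob_norm_ge0/= -(@ler_pXn2r _ 2)// ?nnegrE ?frob_norm_ge0//.
rewrite !sqr_frob_norm; apply: le_trans (frob_le_root_gram_mul (a n) _ c0) _.
rewrite mulmxBr mulmxV ?root_gram_unit// -opprB.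
by rewrite frob_innerNl frob_innerNr opprK.
Qed.

Lemma mxcvg_nonlinear_flow t a A : 0 < t -> mxcvg a A ->
  mxcvg (fun n => nonlinear_flow t (a n)) (nonlinear_flow t A).
Proof.
move=> t0 aA; apply: mxcvg_mul; last exact: mxcvgZ.
by apply: mxcvg_inv_root_gram => //; rewrite subr_ge0 ltW// expR_gt1 mulr_gt0.
Qed.

End mxcvg.

(** Rounding the entries to multiples of 1 / (n + 1) gives a function with countably
    many values, each attained on a measurable set. *)
Lemma measurable_mxcvg_comp (R : realType) (d : measure_display)
    (T : measurableType d) (D : set T) (m : nat) (f : T -> 'M[R]_m)
    (g : 'M[R]_m -> R) : measurable D ->
    (forall a A, mxcvg a A -> g (a n) @[n --> \oo] --> g A) ->
    (forall i j, measurable_fun D (fun x => f x i j)) ->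
  measurable_fun D (fun x => g (f x)).
Proof.
move=> mD gc mf.
pose rnd n (x : T) : 'M[int]_m := \matrix_(i, j) Num.floor (f x i j * n.+1%:R).
pose grid n (z : 'M[int]_m) : 'M[R]_m := \matrix_(i, j) ((z i j)%:~R / n.+1%:R).
have rnd_cvg x : mxcvg (fun n => grid n (rnd n x)) (f x).
  move=> i j; apply/subr_cvg0; apply: norm_cvg0.
  apply: (@squeeze_cvgr _ _ _ _ (cst 0) (@harmonic R)); last 2 first.
  - exact: cvg_cst.
  - exact: cvg_harmonic.
  apply: nearW => n; rewrite normr_ge0/= !mxE.
  have n0 : 0 < n.+1%:R :> R by rewrite ltr0n.
  set y := f x i j; have := floor_itv (y * n.+1%:R) => /andP[h1 h2].
  rewrite ler0_norm; last by rewrite subr_le0 ler_pdivrMr.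
  rewrite opprB lerBlDl -[X in _ + X]mul1r -mulrDl ler_pdivlMr//.
  by move: h2; rewrite intrD => /ltW.
have mrnd n : measurable_fun D (fun x => g (grid n (rnd n x))).
  move=> _ Y mY.
  pose cell (z : int) : set R := [set r | Num.floor (r * n.+1%:R) = z].
  have mcell z : measurable (cell z).
    rewrite (_ : cell z = `[z%:~R / n.+1%:R, (z + 1)%:~R / n.+1%:R[%classic).
      exact: measurable_itv.
    have n0 : 0 < n.+1%:R :> R by rewrite ltr0n.
    apply/seteqP; split => r; rewrite /= in_itv/= ler_pdivrMr// ltr_pdivlMr//.
      by move=> <-; exact: floor_itv.
    exact: floor_def.
  rewrite (_ : _ `&` _ = \bigcup_(z : 'M[int]_m) (if g (grid n z) \in Y then
      D `&` \bigcap_(ij in [set: 'I_m * 'I_m])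
        (D `&` (fun x => f x ij.1 ij.2) @^-1` cell (z ij.1 ij.2)) else set0)).
    apply: countable_bigcupT_measurable; first exact: countableP.
    move=> z; case: ifPn => // _; apply: measurableI => //.
    apply: fin_bigcap_measurable; first exact: finite_finset.
    by move=> [i j] _; exact: mf.
  apply/seteqP; split => x.
    move=> [Dx Yx]; exists (rnd n x) => //; rewrite ifT ?inE//; split=> //.
    by move=> [i j] _; split=> //=; rewrite /cell/= mxE.
  move=> [z _]; case: ifPn => // /set_mem Yz [Dx zx]; split=> //=.
  suff -> : rnd n x = z by [].
  by apply/matrixP => i j; rewrite mxE; have [] := zx (i, j) Logic.I.
apply: (measurable_fun_cvg mrnd) => x _.
by apply: gc; exact: rnd_cvg.
Qed.

(** * Positivity of the periodic heat kernel in one variable *)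

Section theta.
Context {R : realType}.
Implicit Types (t s z : R) (N : nat).

(** The coefficient of s^r / r! in the double sum is the square of
    the sum of the j^r u_j. *)
Lemma expR_kernel_psd s M (u : nat -> R) : 0 <= s ->
  0 <= \sum_(j < M) \sum_(l < M) expR (s * (j%:R * l%:R)) * (u j * u l).
Proof.
move=> s0.
have cv : \sum_(j < M) \sum_(l < M)
    series (exp_coeff (s * (j%:R * l%:R))) K * (u j * u l) @[K --> \oo] -->
  \sum_(j < M) \sum_(l < M) expR (s * (j%:R * l%:R)) * (u j * u l).
  apply: cvg_sumr => j; apply: cvg_sumr => l; apply: cvgM; last exact: cvg_cst.
  exact: is_cvg_series_exp_coeff.
rewrite -(cvg_lim _ cv)//; apply: limr_ge; first by apply/cvg_ex; eexists; exact: cv.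
apply: nearW => K; rewrite (_ : \sum_(j < M) _ =
    \sum_(0 <= r < K) s ^+ r / r`!%:R * (\sum_(j < M) j%:R ^+ r * u j) ^+ 2).
  apply: sumr_ge0 => r _; rewrite mulr_ge0 ?sqr_ge0// divr_ge0 ?exprn_ge0//.
rewrite [RHS](eq_bigr (fun r => \sum_(j < M) \sum_(l < M)
    (s ^+ r / r`!%:R * ((j%:R ^+ r * u j) * (l%:R ^+ r * u l))))).
  rewrite [RHS]exchange_big/=; apply: eq_bigr => j _.
  rewrite [RHS]exchange_big/=; apply: eq_bigr => l _.
  rewrite /series/= mulr_suml; apply: eq_bigr => r _.
  by rewrite /exp_coeff/= !exprMn; ring.
move=> r _; rewrite expr2 mulr_suml mulr_sumr; apply: eq_bigr => j _.
by rewrite mulr_sumr mulr_sumr.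
Qed.

Definition gauss_coef t (n : int) : R := expR (- (t * n%:~R ^+ 2)).

Lemma gauss_coefN t n : gauss_coef t (- n) = gauss_coef t n.
Proof. by rewrite /gauss_coef mulrNz sqrrN. Qed.

Definition theta_partial t N z : R :=
  \sum_(j < N.*2.+1) gauss_coef t (j%:Z - N%:Z) * cos ((j%:Z - N%:Z)%:~R * z).

Lemma sum_symmetricE (g : int -> R) N : (forall n, g (- n) = g n) ->
  \sum_(j < N.*2.+1) g (j%:Z - N%:Z) = g 0 + \sum_(0 <= n < N) g n.+1%:Z *+ 2.
Proof.
move=> gN; elim: N => [|N IH].
  rewrite double0 big_ord1 big_geq//=.
  by rewrite [RHS]addr0 subrr.
rewrite big_nat_recr//= [RHS]addrA -IH doubleS big_ord_recl big_ord_recr/=.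
have -> : g (0%:Z - N.+1%:Z) = g N.+1%:Z by rewrite -gN; congr g; lia.
rewrite addrCA mulr2n; congr (_ + (_ + _)).
  by apply: eq_bigr => j _; congr g; rewrite /bump/=; lia.
by congr g; rewrite /bump/=; lia.
Qed.

Lemma theta_partialE t N z : theta_partial t N z =
  1 + \sum_(0 <= n < N) (gauss_coef t n.+1%:Z * cos (n.+1%:R * z)) *+ 2.
Proof.
rewrite /theta_partial.
rewrite (sum_symmetricE (g := fun n => gauss_coef t n * cos (n%:~R * z))).
  by rewrite mul0r cos0 mulr1 /gauss_coef expr0n/= mulr0 oppr0 expR0.
by move=> n; rewrite gauss_coefN mulrNz mulNr cosN.
Qed.

(** The Fejer sums of the heat kernel are nonnegative because the Gaussian is
    positive definite: e^{-t (j - l)^2} is e^{-t j^2} e^{-t l^2} times the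
    kernel e^{2 t j l}, whose power series has nonnegative coefficients. *)
Lemma sum_theta_partial_ge0 t M z : 0 < t ->
  0 <= \sum_(0 <= N < M) theta_partial t N z.
Proof.
move=> t0; pose g (n : int) := gauss_coef t n * cos (n%:~R * z).
have gN n : g (- n) = g n by rewrite /g gauss_coefN mulrNz mulNr cosN.
(* The N-th partial sum collects the pairs (j, l) with max(j, l) = N. *)
have -> : \sum_(0 <= N < M) theta_partial t N z =
    \sum_(j < M) \sum_(l < M) g (j%:Z - l%:Z).
  elim: M => [|M IH]; first by rewrite big_ord0 big_geq.
  rewrite big_nat_recr//= IH big_ord_recr/=.
  under [in RHS]eq_bigr do rewrite big_ord_recr/=.
  rewrite big_split/= -addrA; congr (_ + _).
  rewrite big_ord_recr/= subrr /theta_partial (sum_symmetricE _ gN).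
  rewrite [RHS]addrA [RHS]addrC; congr (_ + _).
  under [in LHS]eq_bigr do rewrite mulr2n.
  rewrite big_split/= !big_mkord; congr (_ + _).
    rewrite (reindex_inj rev_ord_inj)/=; apply: eq_bigr => j _.
    by rewrite -gN; congr g; have := ltn_ord j; lia.
  rewrite (reindex_inj rev_ord_inj)/=; apply: eq_bigr => j _.
  by congr g; have := ltn_ord j; lia.
pose a (j : nat) := expR (- (t * j%:R ^+ 2)).
rewrite (_ : \sum_(j < M) _ =
   \sum_(j < M) \sum_(l < M) expR (2 * t * (j%:R * l%:R)) *
     ((a j * cos (j%:R * z)) * (a l * cos (l%:R * z))) +
   \sum_(j < M) \sum_(l < M) expR (2 * t * (j%:R * l%:R)) *
     ((a j * sin (j%:R * z)) * (a l * sin (l%:R * z)))).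
  have t2 : 0 <= 2 * t by rewrite mulr_ge0// ltW.
  have psd (trig : R -> R) := expR_kernel_psd M (fun j => a j * trig (j%:R * z)) t2.
  by rewrite addr_ge0//; exact: psd.
rewrite -big_split; apply: eq_bigr => j _ /=.
rewrite -big_split; apply: eq_bigr => l _ /=.
rewrite /g /gauss_coef intrB -!pmulrn mulrBl cosB.
have -> : - (t * (j%:R - l%:R) ^+ 2) =
  2 * t * (j%:R * l%:R) + - (t * j%:R ^+ 2) + - (t * l%:R ^+ 2) :> R by ring.
by rewrite !expRD -/(a j) -/(a l); ring.
Qed.

Lemma gauss_coef_le_geometric t n : 0 < t ->
  gauss_coef t n.+1%:Z <= geometric 1 (expR (- t)) n.
Proof.
move=> t0; rewrite /gauss_coef /geometric/= mul1r -expRM_natl ler_expR.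
rewrite mulrN lerN2 mulrC -pmulrn; apply: ler_wpM2l; first exact: ltW.
rewrite -natrX ler_nat.
by rewrite expnS expn1 (leq_trans (leqnSn n))// leq_pmulr.
Qed.

Lemma theta_bound t : 0 < t ->
  exists2 C : R, 0 <= C & forall N z, `|theta_partial t N z| <= C.
Proof.
move=> t0; pose q := expR (- t).
have q1 : q < 1 by rewrite expR_lt1 oppr_lt0.
exists (1 + (1 - q)^-1 *+ 2).
  by rewrite addr_ge0// mulrn_wge0// invr_ge0 subr_ge0 ltW.
move=> N z; rewrite theta_partialE (le_trans (ler_normD _ _))// normr1 lerD2l.
rewrite sumrMnl normrMn lerMn2r//= (le_trans (ler_norm_sum _ _ _))//.
have h : \sum_(0 <= n < N) geometric 1 q n <= (1 - q)^-1.
  have := @geometric_seriesE _ 1 q (negbT (lt_eqF q1)) => /(congr1 (@^~ N)).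
  rewrite /series/= => ->; rewrite mul1r ler_piMl// ?invr_ge0 ?subr_ge0 ?ltW//.
  by rewrite ltrBlDr ltrDl exprn_gt0// expR_gt0.
apply: le_trans h; apply: ler_sum => n _; rewrite normrM.
rewrite (le_trans _ (gauss_coef_le_geometric n t0))//.
rewrite ger0_norm ?expR_ge0// ler_piMr ?expR_ge0// ler_norml cos_geN1 cos_le1//.
Qed.

(** The limit is also the limit of the Cesaro means, which are nonnegative. *)
Lemma theta_cvg t z : 0 < t ->
  exists2 l : R, 0 <= l & theta_partial t N z @[N --> \oo] --> l.
Proof.
move=> t0; pose q := expR (- t).
have q1 : q < 1 by rewrite expR_lt1 oppr_lt0.
pose b n := gauss_coef t n.+1%:Z * cos (n.+1%:R * z).
have cb : cvgn (series b).
  apply: normed_cvg; apply: (@series_le_cvg _ _ (geometric 1 q)).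
  - by move=> n; exact: normr_ge0.
  - by move=> n; rewrite /geometric/= mul1r exprn_ge0// expR_ge0.
  - move=> n; rewrite (le_trans _ (gauss_coef_le_geometric n t0))//= normrM.
    by rewrite ger0_norm ?expR_ge0// ler_piMr ?expR_ge0// ler_norml cos_geN1 cos_le1.
  - by apply: is_cvg_geometric_series; rewrite ger0_norm ?expR_ge0.
have cth : theta_partial t N z @[N --> \oo] --> 1 + limn (series b) *+ 2.
  rewrite (_ : theta_partial t ^~ z = (fun N => 1 + series b N *+ 2)).
    by apply: cvgD; [exact: cvg_cst|exact: cvgMn].
  by apply/funext => N; rewrite theta_partialE sumrMnl.
exists (1 + limn (series b) *+ 2) => //.
have ces := cesaro cth.
rewrite -(cvg_lim _ ces)//; apply: limr_ge; first by apply/cvg_ex; eexists; exact: ces.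
apply: nearW => N; rewrite /arithmetic_mean/= mulr_ge0 ?invr_ge0//.
exact: sum_theta_partial_ge0.
Qed.

End theta.

(** * The heat kernel in several variables *)

Section product.
Context {R : realType}.
Implicit Types (t z : R).

Definition cis (z : R) : R[i] := Complex (cos z) (sin z).

Lemma cisD (y z : R) : cis (y + z) = cis y * cis z.
Proof. by rewrite /cis cosD sinD; congr Complex; rewrite addrC [sin y * _]mulrC. Qed.

Lemma cis_sum (I : finType) (z : I -> R) : cis (\sum_i z i) = \prod_i cis (z i).
Proof.
rewrite (big_morph cis (id1 := 1) (op1 := *%R)) //; first exact: cisD.
by rewrite /cis cos0 sin0.
Qed.

(** Frequencies are summed over a box, so that the sum of the complex
    exponentials is a product of one-dimensional sums; each factor is real by
    symmetry. *)
Lemma sum_box_prod_theta t d N (z : 'I_d -> R) :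
  \sum_(k : {ffun 'I_d -> 'I_(N.*2.+1)})
    expR (- (t * freq_sqnorm R (box_freq k))) *
    cos (\sum_i (box_freq k i)%:~R * z i) = \prod_i theta_partial t N (z i).
Proof.
pose a (j : 'I_(N.*2.+1)) := gauss_coef (R := R) t (j%:Z - N%:Z).
pose e i (j : 'I_(N.*2.+1)) := ((a j)%:C * cis ((j%:Z - N%:Z)%:~R * z i))%C.
have sumE i : \sum_j e i j = (theta_partial t N (z i))%:C%C.
  rewrite /theta_partial; apply/eqP; rewrite eq_complex; apply/andP; split.
    rewrite raddf_sum/=; apply/eqP; apply: eq_bigr => j _.
    by rewrite /e /= mul0r subr0.
  rewrite raddf_sum/=; apply/eqP.
  pose S : R := \sum_j a j * sin ((j%:Z - N%:Z)%:~R * z i).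
  have -> : \sum_j complex.Im (e i j) = S.
    by apply: eq_bigr => j _; rewrite /e /= mul0r addr0.
  suff SN : S = - S by lra.
  rewrite {1}/S (reindex_inj rev_ord_inj)/= -sumrN; apply: eq_bigr => j _.
  have E : (N.*2.+1 - j.+1)%N%:Z - N%:Z = - (j%:Z - N%:Z).
    by have := ltn_ord j; lia.
  by rewrite /a/= E gauss_coefN mulrNz mulNr sinN mulrN.
have : \prod_i \sum_j e i j = (\prod_i theta_partial t N (z i))%:C%C.
  by under eq_bigr do rewrite sumE; rewrite rmorph_prod.
rewrite bigA_distr_bigA/= => /(congr1 (@complex.Re R)); rewrite raddf_sum/= => <-.
apply: eq_bigr => k _.
rewrite big_split/= -cis_sum -rmorph_prod/= mul0r subr0.
congr (_ * cos _); last by apply: eq_bigr => i _; rewrite ffunE.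
rewrite /freq_sqnorm mulr_sumr -sumrN expR_sum; apply: eq_bigr => i _.
by rewrite ffunE.
Qed.

End product.

(** * Integration on sets of finite measure *)

Section real_integrals.
Context {R : realType} {disp : measure_display} {T : measurableType disp}.
Context (mu : {measure set T -> \bar R}) (D : set T) (mD : measurable D).
Implicit Types (f g h : T -> R).

Definition L1 f := mu.-integrable D (EFin \o f).

Lemma L1_measurable f : L1 f -> measurable_fun D f.
Proof. by move=> /measurable_int /measurable_EFinP. Qed.

Lemma L1D f g : L1 f -> L1 g -> L1 (fun x => f x + g x).
Proof. by move=> If Ig; apply: eq_integrable (integrableD mD If Ig). Qed.

Lemma L1Z (k : R) f : L1 f -> L1 (fun x => k * f x).
Proof. by move=> If; apply: eq_integrable (integrableZl mD k If). Qed.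

Lemma L1B f g : L1 f -> L1 g -> L1 (fun x => f x - g x).
Proof. by move=> If Ig; apply: eq_integrable (integrableB mD If Ig). Qed.

Lemma L1_0 : L1 (fun=> 0).
Proof. exact: integrable0. Qed.

Lemma L1_sum (I : Type) (r : seq I) (F : I -> T -> R) :
  (forall i, L1 (F i)) -> L1 (fun x => \sum_(i <- r) F i x).
Proof.
move=> IF; elim: r => [|i r IH].
  by under eq_fun do rewrite big_nil; exact: L1_0.
by under eq_fun do rewrite big_cons; exact: L1D.
Qed.

Lemma Rintegral_sum (I : Type) (r : seq I) (F : I -> T -> R) :
  (forall i, L1 (F i)) ->
  \int[mu]_(x in D) (\sum_(i <- r) F i x) =
  \sum_(i <- r) \int[mu]_(x in D) F i x.
Proof.
move=> IF; elim: r => [|i r IH].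
  rewrite big_nil /Rintegral (eq_integral (cst 0%E)) ?integral0// => x _.
  by rewrite big_nil.
rewrite big_cons -IH -RintegralD//; [|exact: IF|exact: L1_sum].
by apply: eq_Rintegral => x _; rewrite big_cons.
Qed.

Lemma L1_mul_bounded (C : R) f h : L1 f -> measurable_fun D h ->
  (forall x, D x -> `|h x| <= C) -> L1 (fun x => f x * h x).
Proof.
move=> If mh hC; apply: eq_integrable (integrableMl mD If mh _) => //.
exists C; split; first exact: num_real.
by move=> y Cy x /hC hx; apply: le_trans hx _; exact: ltW.
Qed.

Lemma Rdominated_convergence (F : nat -> T -> R) f g :
    (forall n, measurable_fun D (F n)) ->
    (forall x, D x -> F n x @[n --> \oo] --> f x) ->
    L1 g -> (forall n x, D x -> `|F n x| <= g x) ->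
  L1 f /\ \int[mu]_(x in D) F n x @[n --> \oo] --> \int[mu]_(x in D) f x.
Proof.
move=> mF Ff Ig Fg.
have mf : measurable_fun D f by exact: measurable_fun_cvg mF Ff.
have [If _ cv] : [/\ mu.-integrable D (EFin \o f),
   [sequence \int[mu]_(x in D) `|(F n x)%:E - (f x)%:E|]_n @ \oo --> 0
 & [sequence \int[mu]_(x in D) (F n x)%:E]_n @ \oo -->
     \int[mu]_(x in D) (f x)%:E]%E.
  apply: (@dominated_convergence _ _ _ mu D mD (fun n x => (F n x)%:E)
    (EFin \o f) (EFin \o g)) => //.
  - by move=> n; exact/measurable_EFinP.
  - exact/measurable_EFinP.
  - by apply: aeW => x Dx; apply: cvg_EFin; [exact: nearW|exact: Ff].
  - by apply: aeW => x n Dx; rewrite /= lee_fin; exact: Fg.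
split=> //; apply: fine_cvg; rewrite fineK//.
exact: integrable_fin_num If.
Qed.

Context (finD : (mu D < +oo)%E).

Lemma L1_bounded (C : R) f : measurable_fun D f ->
  (forall x, D x -> `|f x| <= C) -> L1 f.
Proof.
move=> mf fC; apply: measurable_bounded_integrable => //.
exists C; split; first exact: num_real.
by move=> y Cy x /fC hx; apply: le_trans hx _; exact: ltW.
Qed.

End real_integrals.

(** * The torus and its trigonometric integrals *)

Section torus_integrals.
Context {R : realType}.

Lemma Rd_cons_torus d : @Rd_cons R d @^-1` torus R d.+1 =
  `[- pi, pi]%classic `*` torus R d.
Proof.
apply/seteqP; split => -[x p]; rewrite /torus /Rd_cons /= in_itv/=.
  move=> xp; split; first by have := xp ord0; rewrite (tnth_nth 0).
  by move=> i; have := xp (lift ord0 i); rewrite !(tnth_nth 0).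
move=> [xpi ppi] i; rewrite (tnth_nth 0)/=.
by case: (unliftP ord0 i) => [j|] ->//=; have := ppi j; rewrite (tnth_nth 0).
Qed.

Lemma pi_itv_measure : @lebesgue_measure R `[- pi, pi]%classic = (2 * pi)%:E.
Proof.
rewrite lebesgue_measure_itv/= lte_fin gtrN ?pi_gt0//.
by rewrite -EFinB opprK mulr2n mulrDl mul1r.
Qed.

Lemma measure_torus d : lebesgue_Rd R d (torus R d) = ((2 * pi) ^+ d)%:E.
Proof.
elim: d => [|d IH].
  by rewrite /= diracE mem_set// => -[].
rewrite /= /lebesgue_cons /pushforward Rd_cons_torus.
rewrite product_measure1E//; last exact: measurable_torus.
by rewrite [X in (X * _)%E]pi_itv_measure IH -EFinM exprS.
Qed.

Lemma finite_torus d : (lebesgue_Rd R d (torus R d) < +oo)%E.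
Proof. by rewrite measure_torus ltry. Qed.

(** Fubini's theorem for a product of a function of the first coordinate and a
    function of the others. *)
Lemma Rintegral_torusM d (g : R -> R) (h : Rd R d -> R) (Cg Ch : R) :
    measurable_fun setT g -> measurable_fun setT h ->
    (forall x, `|g x| <= Cg) -> (forall y, `|h y| <= Ch) ->
  \int[lebesgue_Rd R d.+1]_(q in torus R d.+1)
    (g (thead q) * h [tuple of behead q]) =
  (\int[lebesgue_measure]_(x in `[- pi, pi]) g x) *
  (\int[lebesgue_Rd R d]_(y in torus R d) h y).
Proof.
move=> mg mh gC hC; pose mu := lebesgue_Rd R d.
pose lam : {sigma_finite_measure set (measurableTypeR R) -> \bar R} :=
  @lebesgue_measure R.
pose I : set (measurableTypeR R) := `[- pi, pi]%classic.
have mI : measurable I by exact: measurable_itv.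
have mT := @measurable_torus R d.
pose F (q : Rd R d.+1) : \bar R := (g (thead q) * h [tuple of behead q])%:E.
have mF : measurable_fun setT F.
  apply/measurable_EFinP; apply: measurable_funM.
    by apply: measurableT_comp => //; exact: measurable_tnth.
  by apply: measurableT_comp => //; exact: measurable_behead.
have FE : F \o @Rd_cons R d = (fun p => (g p.1 * h p.2)%:E).
  apply/funext => -[x p]; rewrite /F/= theadE; congr (_ * h _)%:E.
  exact: val_inj.
have finP : ((lam \x mu)%E (I `*` torus R d) < +oo)%E.
  rewrite product_measure1E// [X in (X * _)%E]pi_itv_measure.
  by rewrite [X in (_ * X)%E]measure_torus -EFinM ltry.
have intF : (lam \x mu)%E.-integrable (I `*` torus R d) (F \o @Rd_cons R d).
  rewrite FE; apply: (@L1_bounded _ _ _ _ _ _ _ (Cg * Ch)).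
  - exact: measurableX.
  - exact: finP.
  - apply: measurable_funTS; apply: measurable_funM.
      by apply: measurableT_comp => //; exact: measurable_fst.
    by apply: measurableT_comp => //; exact: measurable_snd.
  - by move=> [x y] _; rewrite normrM ler_pM.
have intg : lam.-integrable I (EFin \o g).
  apply: (@L1_bounded _ _ _ _ _ _ _ Cg) => //; last exact: measurable_funTS.
  by rewrite [X in (X < _)%E]pi_itv_measure ltry.
have inth : mu.-integrable (torus R d) (EFin \o h).
  apply: (@L1_bounded _ _ _ _ _ _ _ Ch) => //; last exact: measurable_funTS.
  exact: finite_torus.
rewrite /Rintegral -[in RHS]fineM ?integrable_fin_num//; congr fine.
transitivity (\int[(lam \x mu)%E]_(p in I `*` torus R d) (g p.1 * h p.2)%:E)%E.
  rewrite -FE -Rd_cons_torus.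
  transitivity (\int[pushforward (lam \x mu)%E (@Rd_cons R d)]_(q in torus R d.+1)
      F q)%E; first exact: eq_measure_integral.
  apply: integral_pushforward => //; last exact: measurable_torus.
  by rewrite Rd_cons_torus.
pose H := (fun p : measurableTypeR R * Rd R d => (g p.1 * h p.2)%:E)
  \_ (I `*` torus R d).
have intH : (lam \x mu)%E.-integrable setT H.
  rewrite FE in intF; have mIT := measurableX mI mT.
  have [+ _] := @integrable_mkcond _ _ _ (lam \x mu)%E _
    (fun p => (g p.1 * h p.2)%:E) mIT.
  exact.
rewrite [LHS]integral_mkcond.
transitivity (\int[lam]_x fubini_F mu H x)%E.
  exact/esym/(integral12_prod_meas1 intH).
pose ch : R := fine (\int[mu]_(y in torus R d) (h y)%:E)%E.
have chE : (\int[mu]_(y in torus R d) (h y)%:E)%E = ch%:E.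
  by rewrite fineK// integrable_fin_num.
rewrite -/mu chE -(integralZr mI intg) [RHS]integral_mkcond.
apply: eq_integral => x _; rewrite /fubini_F /H patchE; case: ifPn => [xI|xI].
  rewrite -chE -integralZl//= [RHS]integral_mkcond; apply: eq_integral => y _.
  rewrite !patchE; congr (if _ then _ else _).
  by move: xI; rewrite inE => xI; apply/idP/idP; rewrite !inE; [case|split].
rewrite (eq_integral (cst 0%E)) ?integral0// => y _.
rewrite patchE ifF//; apply: contraNF xI.
by rewrite !inE => -[].
Qed.

End torus_integrals.

(** * Trigonometric integrals *)

Section trigonometric_integrals.
Context {R : realType}.
Local Notation lam := (@lebesgue_measure R).

Lemma measurable_sin : measurable_fun [set: R] (@sin R).
Proof. by apply: continuous_measurable_fun => x; exact: continuous_sin. Qed.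

Lemma measurable_cos : measurable_fun [set: R] (@cos R).
Proof. by apply: continuous_measurable_fun => x; exact: continuous_cos. Qed.

Lemma normr_cos_le1 (x : R) : `|cos x| <= 1.
Proof. by rewrite ler_norml cos_geN1 cos_le1. Qed.

Lemma normr_sin_le1 (x : R) : `|sin x| <= 1.
Proof. by rewrite ler_norml sin_geN1 sin_le1. Qed.

Lemma Rintegral_FTC (f F : R -> R) (a b : R) : a < b ->
  (forall x : R, is_derive x (1 : R) F (f x)) -> continuous f ->
  \int[lam]_(x in `[a, b]) f x = F b - F a.
Proof.
move=> ab dF cf.
have cF (x : R) : {for x, continuous F}.
  apply: differentiable_continuous; apply/derivable1_diffP.
  by have [] := dF x.
rewrite /Rintegral (@continuous_FTC2 _ f F)//.
- exact: continuous_subspaceT.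
- split=> [x _||]; first by have [] := dF x.
  + exact: cvg_at_right_filter (cF a).
  + exact: cvg_at_left_filter (cF b).
- by move=> x _; rewrite derive1E; exact: derive_val.
Qed.

Lemma sin_int_pi (n : int) : sin (n%:~R * pi) = 0 :> R.
Proof.
have sn (m : nat) : sin (m%:R * pi) = 0 :> R.
  elim: m => [|m IH]; first by rewrite mul0r sin0.
  by rewrite -natr1 mulrDl mul1r sinDpi IH oppr0.
by case: n => m; [exact: sn|rewrite NegzE mulrNz mulNr sinN sn oppr0].
Qed.

Lemma Rintegral_cos_int (n : int) :
  \int[lam]_(x in `[- pi, pi]) cos (n%:~R * x) = if n == 0 then 2 * pi else 0.
Proof.
have ltpi : - pi < pi :> R by rewrite gtrN ?pi_gt0.
have [->|n0] := eqVneq n 0.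
  rewrite (_ : (fun x => _) = cst 1).
    rewrite (@Rintegral_FTC _ id)//; first by rewrite opprK; lra.
    exact: cst_continuous.
  by apply/funext => x; rewrite mul0r cos0.
have nR : n%:~R != 0 :> R by rewrite intr_eq0.
apply: etrans (@Rintegral_FTC _ (fun x => n%:~R^-1 * sin (n%:~R * x)) _ _
  ltpi _ _) _ => //; last by rewrite mulrN sinN sin_int_pi oppr0 subrr.
- move=> x; apply: is_derive_eq.
  by rewrite /GRing.scale/=; field.
- move=> x; apply: continuous_comp; last exact: continuous_cos.
  exact: mulrl_continuous.
Qed.

Lemma Rintegral_sin_int (n : int) :
  \int[lam]_(x in `[- pi, pi]) sin (n%:~R * x) = 0.
Proof.
have ltpi : - pi < pi :> R by rewrite gtrN ?pi_gt0.
have [->|n0] := eqVneq n 0.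
  rewrite (_ : (fun x => _) = cst 0).
    rewrite (@Rintegral_FTC _ (cst 0))//; first by rewrite subrr.
    exact: cst_continuous.
  by apply/funext => x; rewrite mul0r sin0.
have nR : n%:~R != 0 :> R by rewrite intr_eq0.
apply: etrans (@Rintegral_FTC _ (fun x => - (n%:~R^-1 * cos (n%:~R * x))) _ _
  ltpi _ _) _ => //; last by rewrite mulrN cosN subrr.
- move=> x; apply: is_derive_eq.
  by rewrite /GRing.scale/=; field.
- move=> x; apply: continuous_comp; last exact: continuous_sin.
  exact: mulrl_continuous.
Qed.

Implicit Types d : nat.

Lemma measurable_freq_dot d (k : {ffun 'I_d -> int}) :
  measurable_fun [set: Rd R d] (freq_dot k).
Proof.
apply: measurable_sum => i; apply: measurable_funM => //.
exact: measurable_tnth.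
Qed.

Lemma measurable_cos_freq d (k : {ffun 'I_d -> int}) :
  measurable_fun [set: Rd R d] (fun x => cos (freq_dot k x)).
Proof. exact: measurableT_comp measurable_cos (measurable_freq_dot k). Qed.

Lemma measurable_sin_freq d (k : {ffun 'I_d -> int}) :
  measurable_fun [set: Rd R d] (fun x => sin (freq_dot k x)).
Proof. exact: measurableT_comp measurable_sin (measurable_freq_dot k). Qed.

Lemma freq_dot_cons d (k : {ffun 'I_d.+1 -> int}) (q : Rd R d.+1) :
  freq_dot k q = (k ord0)%:~R * thead q +
    freq_dot [ffun i => k (lift ord0 i)] [tuple of behead q].
Proof.
rewrite /freq_dot big_ord_recl; congr (_ + _); apply: eq_bigr => i _.
by rewrite ffunE; congr (_ * _); rewrite !(tnth_nth 0)/= nth_behead.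
Qed.

(** The cosine and the sine are treated together, as the addition formulas
    used to split off the first coordinate mix them. *)
Lemma Rintegral_trig_freq d (k : {ffun 'I_d -> int}) :
  \int[lebesgue_Rd R d]_(x in torus R d) cos (freq_dot k x) =
    (if k == 0 then (2 * pi) ^+ d else 0) /\
  \int[lebesgue_Rd R d]_(x in torus R d) sin (freq_dot k x) = 0.
Proof.
elim: d k => [|d IH] k.
  have fd0 x : freq_dot k x = 0 :> R by rewrite /freq_dot big_ord0.
  have -> : k = 0 by apply/ffunP => -[].
  rewrite eqxx expr0; split.
    rewrite (@eq_Rintegral _ _ _ _ _ (cst 1)); last first.
      by move=> x _; rewrite /freq_dot big_ord0 cos0.
    rewrite Rintegral_cst; last exact: measurable_torus.
    by rewrite [X in fine X]measure_torus mul1r.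
  rewrite (@eq_Rintegral _ _ _ _ _ (cst 0)) ?Rintegral_cst ?mul0r//.
    exact: measurable_torus.
  by move=> x _; rewrite /freq_dot big_ord0 sin0.
set k0 := k ord0; set k' : {ffun 'I_d -> int} := [ffun i => k (lift ord0 i)].
have [IHc IHs] := IH k'.
have mT := @measurable_torus R d.+1.
have mk0 (trig : R -> R) : measurable_fun setT trig ->
    measurable_fun setT (fun x : R => trig (k0%:~R * x)).
  move=> mt; apply: measurableT_comp => //; exact: measurable_funM.
have prodE (t1 t2 : R -> R) : measurable_fun setT t1 -> measurable_fun setT t2 ->
    (forall x, `|t1 x| <= 1) -> (forall x, `|t2 x| <= 1) ->
    L1 (lebesgue_Rd R d.+1) (torus R d.+1)
      (fun q => t1 (k0%:~R * thead q) * t2 (freq_dot k' [tuple of behead q])) /\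
    \int[lebesgue_Rd R d.+1]_(q in torus R d.+1)
      (t1 (k0%:~R * thead q) * t2 (freq_dot k' [tuple of behead q])) =
    (\int[lam]_(x in `[- pi, pi]) t1 (k0%:~R * x)) *
    (\int[lebesgue_Rd R d]_(y in torus R d) t2 (freq_dot k' y)).
  move=> mt1 mt2 b1 b2; split.
    apply: (@L1_bounded _ _ _ _ _ _ _ 1) => //.
    - exact: finite_torus.
    - apply: measurable_funTS; apply: measurable_funM.
        apply: (measurableT_comp (mk0 _ mt1)); exact: measurable_tnth.
      apply: (measurableT_comp mt2).
      apply: (measurableT_comp (measurable_freq_dot k')).
      exact: measurable_behead.
    - by move=> q _; rewrite normrM mulr_ile1.
  apply: (@Rintegral_torusM _ d (fun x => t1 (k0%:~R * x))
    (fun y => t2 (freq_dot k' y)) 1 1) => //; first exact: mk0.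
  exact: measurableT_comp mt2 (measurable_freq_dot k').
have [Lcc Ecc] :=
  prodE _ _ measurable_cos measurable_cos normr_cos_le1 normr_cos_le1.
have [Lss Ess] :=
  prodE _ _ measurable_sin measurable_sin normr_sin_le1 normr_sin_le1.
have [Lsc Esc] :=
  prodE _ _ measurable_sin measurable_cos normr_sin_le1 normr_cos_le1.
have [Lcs Ecs] :=
  prodE _ _ measurable_cos measurable_sin normr_cos_le1 normr_sin_le1.
split.
  under eq_Rintegral do rewrite freq_dot_cons -/k0 -/k' cosD.
  rewrite RintegralB// Ecc Ess IHc IHs mulr0 subr0 Rintegral_cos_int.
  have -> : (k == 0) = (k0 == 0) && (k' == 0).
    apply/eqP/andP => [kE|[/eqP k00 /eqP k'0]].
      have k_0 i : k i = 0 by rewrite kE ffunE.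
      by split; apply/eqP; [exact: k_0|apply/ffunP => i; rewrite !ffunE].
    apply/ffunP => i; rewrite ffunE; case: (unliftP ord0 i) => [j|] ->//.
    by move/ffunP/(_ j): k'0; rewrite !ffunE.
  by case: eqP => _ /=; rewrite ?mul0r//; case: eqP => _; rewrite ?mulr0// exprS.
under eq_Rintegral do rewrite freq_dot_cons -/k0 -/k' sinD.
by rewrite RintegralD// Esc Ecs IHs Rintegral_sin_int mul0r mulr0 addr0.
Qed.

Lemma Rintegral_cos_freq d (k : {ffun 'I_d -> int}) :
  \int[lebesgue_Rd R d]_(x in torus R d) cos (freq_dot k x) =
    if k == 0 then (2 * pi) ^+ d else 0.
Proof. by have [] := Rintegral_trig_freq k. Qed.

Lemma Rintegral_sin_freq d (k : {ffun 'I_d -> int}) :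
  \int[lebesgue_Rd R d]_(x in torus R d) sin (freq_dot k x) = 0.
Proof. by have [] := Rintegral_trig_freq k. Qed.

End trigonometric_integrals.

(** * The heat semigroup as a convolution with a positive kernel *)

Lemma Rintegral_le_off_null (R : realType) (disp : measure_display)
    (T : measurableType disp) (mu : {measure set T -> \bar R}) (D N : set T)
    (f g : T -> R) : measurable D -> measurable N -> mu (N `&` D) = 0%E ->
    L1 mu D f -> L1 mu D g -> (forall x, D x -> ~ N x -> f x <= g x) ->
  \int[mu]_(x in D) f x <= \int[mu]_(x in D) g x.
Proof.
move=> mD mN N0 If Ig fg; have mND : measurable (N `&` D) by exact: measurableI.
rewrite /Rintegral.
rewrite (@negligible_integral _ _ _ _ _ _ (EFin \o f) mND mD If N0).
rewrite (@negligible_integral _ _ _ _ _ _ (EFin \o g) mND mD Ig N0).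
have mDN : measurable (D `\` (N `&` D)) by exact: measurableD.
have If' : mu.-integrable (D `\` (N `&` D)) (EFin \o f) by exact: integrableS If.
have Ig' : mu.-integrable (D `\` (N `&` D)) (EFin \o g) by exact: integrableS Ig.
apply: fine_le; [exact: integrable_fin_num|exact: integrable_fin_num|].
apply: le_integral => // x; rewrite inE => -[Dx nx].
by rewrite lee_fin fg// => Nx; apply: nx.
Qed.

Section heat_kernel.
Context {R : realType} {d m : nat}.
Local Notation mu := (lebesgue_Rd R d).
Local Notation T := (torus R d).
Implicit Types (t : R) (N : nat) (x y : Rd R d) (U : Rd R d -> 'M[R]_m)
  (k l : {ffun 'I_d -> int}).

Let mT : measurable T. Proof. exact: measurable_torus. Qed.
Let finT : (mu T < +oo)%E. Proof. exact: finite_torus. Qed.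

Definition L1mx U := forall i j, L1 mu T (fun x => U x i j).

Definition heat_kernel_partial t N x y : R :=
  \prod_i theta_partial t N (tnth x i - tnth y i).

Definition theta t z : R := limn (fun N => theta_partial t N z).

Definition heat_kernel t x y : R := \prod_i theta t (tnth x i - tnth y i).

Lemma theta_cvgn t z : 0 < t -> theta_partial t N z @[N --> \oo] --> theta t z.
Proof. by move=> t0; have [l _ cl] := theta_cvg z t0; apply/cvg_ex; exists l. Qed.

Lemma theta_ge0 t z : 0 < t -> 0 <= theta t z.
Proof.
by move=> t0; have [l l0 cl] := theta_cvg z t0; rewrite /theta (cvg_lim _ cl).
Qed.

Lemma heat_kernel_cvg t x y : 0 < t ->
  heat_kernel_partial t N x y @[N --> \oo] --> heat_kernel t x y.
Proof.
move=> t0; apply: cvg_big => [|i _]; last exact: theta_cvgn.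
by move=> z; exact: mul_continuous.
Qed.

Lemma heat_kernel_ge0 t x y : 0 < t -> 0 <= heat_kernel t x y.
Proof. by move=> t0; apply: prodr_ge0 => i _; exact: theta_ge0. Qed.

Lemma heat_kernel_partial_bound t : 0 < t ->
  exists2 C : R, 0 <= C & forall N x y, `|heat_kernel_partial t N x y| <= C.
Proof.
move=> t0; have [C C0 hC] := theta_bound t0; exists (C ^+ d).
  exact: exprn_ge0.
move=> N x y; rewrite normr_prod -[X in C ^+ X]card_ord -prodr_const.
by apply: ler_prod => i _; rewrite normr_ge0 hC.
Qed.

Lemma heat_kernel_partialE t N x y : heat_kernel_partial t N x y =
  \sum_(k : {ffun 'I_d -> 'I_(N.*2.+1)})
    expR (- (t * freq_sqnorm R (box_freq k))) *
    (cos (freq_dot (box_freq k) x) * cos (freq_dot (box_freq k) y) +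
     sin (freq_dot (box_freq k) x) * sin (freq_dot (box_freq k) y)).
Proof.
rewrite /heat_kernel_partial -sum_box_prod_theta; apply: eq_bigr => k _.
rewrite -cosB /freq_dot -sumrB; congr (_ * cos _).
by apply: eq_bigr => i _; rewrite mulrBr.
Qed.

Lemma measurable_heat_kernel_partial t N x :
  measurable_fun setT (heat_kernel_partial t N x).
Proof.
rewrite (funext (heat_kernel_partialE t N x)).
apply: measurable_sum => k; apply: measurable_funM => //.
apply: measurable_funD; apply: measurable_funM => //.
  exact: measurable_cos_freq.
exact: measurable_sin_freq.
Qed.

Lemma L1_mul_trig (f h : Rd R d -> R) : L1 mu T f -> measurable_fun setT h ->
  (forall x, `|h x| <= 1) -> L1 mu T (fun x => f x * h x).
Proof. by move=> If mh hb; apply: (L1_mul_bounded mT If (measurable_funTS mh)). Qed.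

Lemma L1_mul_cos (f : Rd R d -> R) k : L1 mu T f ->
  L1 mu T (fun x => f x * cos (freq_dot k x)).
Proof.
move=> If; apply: L1_mul_trig => // [|x]; last exact: normr_cos_le1.
exact: measurable_cos_freq.
Qed.

Lemma L1_mul_sin (f : Rd R d -> R) k : L1 mu T f ->
  L1 mu T (fun x => f x * sin (freq_dot k x)).
Proof.
move=> If; apply: L1_mul_trig => // [|x]; last exact: normr_sin_le1.
exact: measurable_sin_freq.
Qed.

Lemma multiplier_partialE (p : R -> R) U N x i j : multiplier_partial p U N x i j =
  \sum_(k : {ffun 'I_d -> 'I_(N.*2.+1)}) p (freq_sqnorm R (box_freq k)) *
    (cos (freq_dot (box_freq k) x) * fourier_cos U (box_freq k) i j +
     sin (freq_dot (box_freq k) x) * fourier_sin U (box_freq k) i j).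
Proof. by rewrite summxE; apply: eq_bigr => k _; rewrite !mxE. Qed.

Definition heat_symbol t : R -> R := fun s => expR (- (t * s)).

Lemma heat_partial_kernel t U N x i j : L1mx U ->
  multiplier_partial (heat_symbol t) U N x i j =
  (2 * pi) ^- d * \int[mu]_(y in T) (U y i j * heat_kernel_partial t N x y).
Proof.
move=> IU; rewrite multiplier_partialE.
transitivity ((2 * pi) ^- d * \sum_(k : {ffun 'I_d -> 'I_(N.*2.+1)})
  \int[mu]_(y in T) (expR (- (t * freq_sqnorm R (box_freq k))) *
    (cos (freq_dot (box_freq k) x) * (U y i j * cos (freq_dot (box_freq k) y)) +
     sin (freq_dot (box_freq k) x) * (U y i j * sin (freq_dot (box_freq k) y))))).
  rewrite mulr_sumr; apply: eq_bigr => k _.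
  have Lc := L1_mul_cos (box_freq k) (IU i j).
  have Ls := L1_mul_sin (box_freq k) (IU i j).
  rewrite RintegralZl//; last by apply: L1D => //; exact: L1Z.
  rewrite RintegralD//; [|exact: L1Z|exact: L1Z].
  rewrite !RintegralZl// !mxE /heat_symbol; ring.
rewrite -Rintegral_sum//; last first.
  move=> k; apply: L1Z => //; apply: L1D => //; apply: L1Z => //.
    exact: L1_mul_cos.
  exact: L1_mul_sin.
congr (_ * _); apply: eq_Rintegral => y _.
rewrite heat_kernel_partialE mulr_sumr; apply: eq_bigr => k _; ring.
Qed.

(** The partial sums are bounded uniformly, not just convergent: this is what
    dominated convergence needs each time a limit of partial Fourier sums is
    integrated below. *)
Lemma heat_partial_bound t U : 0 < t -> L1mx U ->
  exists2 C : R, 0 <= C &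
    forall N x i j, `|multiplier_partial (heat_symbol t) U N x i j| <= C.
Proof.
move=> t0 IU; have [C C0 hC] := heat_kernel_partial_bound t0.
pose I i j := \int[mu]_(y in T) `|U y i j|.
have LI i j : L1 mu T (fun y => `|U y i j|) by apply: integrable_norm; exact: IU.
have I0 i j : 0 <= I i j by apply: Rintegral_ge0 => x _; exact: normr_ge0.
have pi0 : 0 <= (2 * pi) ^- d :> R.
  by rewrite invr_ge0 exprn_ge0// mulr_ge0// pi_ge0.
exists ((2 * pi) ^- d * (C * \sum_i \sum_j I i j)).
  by rewrite !mulr_ge0// sumr_ge0// => i _; rewrite sumr_ge0.
move=> N x i j; rewrite heat_partial_kernel// normrM ger0_norm// ler_wpM2l//.
have LUK : L1 mu T (fun y => U y i j * heat_kernel_partial t N x y).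
  apply: (L1_mul_bounded mT (IU i j)) => [|y _]; last exact: hC.
  exact: measurable_funTS (measurable_heat_kernel_partial t N x).
apply: (le_trans (le_normr_Rintegral mT LUK)).
apply: (@le_trans _ _ (\int[mu]_(y in T) (C * `|U y i j|))).
  apply: le_Rintegral => //; first exact: integrable_norm LUK.
    exact: L1Z.
  by move=> y _; rewrite normrM mulrC ler_wpM2r.
rewrite RintegralZl//; last exact: LI.
rewrite ler_wpM2l// (bigD1 i)//= (bigD1 j)//= -addrA lerDl.
by rewrite addr_ge0 ?sumr_ge0// => a _; rewrite sumr_ge0.
Qed.

Lemma L1_mul_heat_kernel t x (f : Rd R d -> R) : 0 < t -> L1 mu T f ->
  L1 mu T (fun y => f y * heat_kernel t x y) /\
  \int[mu]_(y in T) (f y * heat_kernel_partial t N x y) @[N --> \oo] -->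
  \int[mu]_(y in T) (f y * heat_kernel t x y).
Proof.
move=> t0 If; have [C C0 hC] := heat_kernel_partial_bound t0.
apply: (@Rdominated_convergence _ _ _ mu T mT
  (fun N y => f y * heat_kernel_partial t N x y) _ (fun y => C * `|f y|)).
- move=> N; apply: measurable_funM; first exact: L1_measurable If.
  exact: measurable_funTS (measurable_heat_kernel_partial t N x).
- by move=> y _; apply: cvgM; [exact: cvg_cst|exact: heat_kernel_cvg].
- by apply: L1Z => //; exact: integrable_norm.
- by move=> N y _; rewrite normrM mulrC ler_wpM2r.
Qed.

Lemma heat_partial_cvg t U x i j : 0 < t -> L1mx U ->
  multiplier_partial (heat_symbol t) U N x i j @[N --> \oo] -->
  (2 * pi) ^- d * \int[mu]_(y in T) (U y i j * heat_kernel t x y).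
Proof.
move=> t0 IU; under eq_fun do rewrite heat_partial_kernel//.
apply: cvgM; first exact: cvg_cst.
by have [] := L1_mul_heat_kernel x t0 (IU i j).
Qed.

Lemma heatE t U x i j : 0 < t -> L1mx U ->
  heat t U x i j = (2 * pi) ^- d * \int[mu]_(y in T) (U y i j * heat_kernel t x y).
Proof.
by move=> t0 IU; rewrite /heat mxE; apply: cvg_lim => //; exact: heat_partial_cvg.
Qed.

Lemma heat_cvg t U x i j : 0 < t -> L1mx U ->
  multiplier_partial (heat_symbol t) U N x i j @[N --> \oo] --> heat t U x i j.
Proof. by move=> t0 IU; rewrite heatE//; exact: heat_partial_cvg. Qed.

Lemma measurable_multiplier_partial (p : R -> R) U N i j :
  measurable_fun setT (fun x => multiplier_partial p U N x i j).
Proof.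
under eq_fun do rewrite multiplier_partialE.
apply: measurable_sum => k; apply: measurable_funM => //.
apply: measurable_funD; apply: measurable_funM => //.
  exact: measurable_cos_freq.
exact: measurable_sin_freq.
Qed.

Lemma measurable_heat t U i j : 0 < t -> L1mx U ->
  measurable_fun setT (fun x => heat t U x i j).
Proof.
move=> t0 IU; apply: (@measurable_fun_cvg _ _ _ _
  (fun N x => multiplier_partial (heat_symbol t) U N x i j)).
  by move=> N; exact: measurable_multiplier_partial.
by move=> x _; exact: heat_cvg.
Qed.

Lemma heat_bound t U : 0 < t -> L1mx U ->
  exists2 C : R, 0 <= C & forall x i j, `|heat t U x i j| <= C.
Proof.
move=> t0 IU; have [C C0 hC] := heat_partial_bound t0 IU; exists C => // x i j.
have cv : `|multiplier_partial (heat_symbol t) U N x i j| @[N --> \oo] -->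
    `|heat t U x i j| by apply: cvg_norm; exact: heat_cvg.
rewrite -(cvg_lim _ cv)//; apply: limr_le; first by apply/cvg_ex; eexists; exact: cv.
by apply: nearW => N; exact: hC.
Qed.

Lemma L1mx_heat t U : 0 < t -> L1mx U -> L1mx (heat t U).
Proof.
move=> t0 IU i j; have [C C0 hC] := heat_bound t0 IU.
apply: (L1_bounded mT finT (C := C)) => [|x _]; last exact: hC.
exact: measurable_funTS (measurable_heat i j t0 IU).
Qed.

End heat_kernel.

(** * Orthogonality of the trigonometric system *)

Section orthogonality.
Context {R : realType} {d : nat}.
Local Notation mu := (lebesgue_Rd R d).
Local Notation T := (torus R d).
Local Notation vol := ((2 * pi) ^+ d : R).
Implicit Types (k l : {ffun 'I_d -> int}) (x : Rd R d) (N : nat).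

Let mT : measurable T. Proof. exact: measurable_torus. Qed.
Let finT : (mu T < +oo)%E. Proof. exact: finite_torus. Qed.

Lemma vol_gt0 : 0 < vol. Proof. by rewrite exprn_gt0// mulr_gt0// pi_gt0. Qed.

Lemma freq_dotD k l x : freq_dot (k + l) x = freq_dot k x + freq_dot l x.
Proof.
by rewrite -big_split; apply: eq_bigr => i _; rewrite ffunE intrD mulrDl.
Qed.

Lemma freq_dotN k x : freq_dot (- k) x = - freq_dot k x.
Proof. by rewrite -sumrN; apply: eq_bigr => i _; rewrite ffunE mulrNz mulNr. Qed.

Lemma freq_dot0 x : freq_dot (0 : {ffun 'I_d -> int}) x = 0.
Proof. by rewrite /freq_dot big1// => i _; rewrite ffunE mul0r. Qed.

Lemma freq_sqnormN k : freq_sqnorm R (- k) = freq_sqnorm R k.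
Proof. by apply: eq_bigr => i _; rewrite ffunE mulrNz sqrrN. Qed.

Lemma L1_trig (h : Rd R d -> R) : measurable_fun setT h ->
  (forall x, `|h x| <= 1) -> L1 mu T h.
Proof.
by move=> mh hb; apply: (L1_bounded mT finT (C := 1)) => //; exact: measurable_funTS.
Qed.

Lemma L1_cos k : L1 mu T (fun x => cos (freq_dot k x)).
Proof.
by apply: L1_trig => [|x]; [exact: measurable_cos_freq|exact: normr_cos_le1].
Qed.

Lemma L1_sin k : L1 mu T (fun x => sin (freq_dot k x)).
Proof.
by apply: L1_trig => [|x]; [exact: measurable_sin_freq|exact: normr_sin_le1].
Qed.

Lemma Rintegral_cos_cos k l :
  \int[mu]_(x in T) (cos (freq_dot k x) * cos (freq_dot l x)) =
  vol / 2 * ((k == l)%:R + (k == - l)%:R).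
Proof.
transitivity (\int[mu]_(x in T)
    (2^-1 * (cos (freq_dot (k - l) x) + cos (freq_dot (k + l) x)))).
  apply: eq_Rintegral => x _; rewrite !freq_dotD freq_dotN cosB cosD.
  by field.
rewrite RintegralZl//; last by apply: L1D => //; exact: L1_cos.
rewrite RintegralD//; [|exact: L1_cos|exact: L1_cos].
rewrite !Rintegral_cos_freq subr_eq0 addr_eq0.
by case: (k == l); case: (k == - l) => /=; field.
Qed.

Lemma Rintegral_sin_sin k l :
  \int[mu]_(x in T) (sin (freq_dot k x) * sin (freq_dot l x)) =
  vol / 2 * ((k == l)%:R - (k == - l)%:R).
Proof.
transitivity (\int[mu]_(x in T)
    (2^-1 * (cos (freq_dot (k - l) x) - cos (freq_dot (k + l) x)))).
  apply: eq_Rintegral => x _; rewrite !freq_dotD freq_dotN cosB cosD.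
  by field.
rewrite RintegralZl//; last by apply: L1B => //; exact: L1_cos.
rewrite RintegralB//; [|exact: L1_cos|exact: L1_cos].
rewrite !Rintegral_cos_freq subr_eq0 addr_eq0.
by case: (k == l); case: (k == - l) => /=; field.
Qed.

Lemma Rintegral_sin_cos k l :
  \int[mu]_(x in T) (sin (freq_dot k x) * cos (freq_dot l x)) = 0.
Proof.
transitivity (\int[mu]_(x in T)
    (2^-1 * (sin (freq_dot (k - l) x) + sin (freq_dot (k + l) x)))).
  apply: eq_Rintegral => x _; rewrite !freq_dotD freq_dotN sinB sinD.
  by field.
rewrite RintegralZl//; last by apply: L1D => //; exact: L1_sin.
rewrite RintegralD//; [|exact: L1_sin|exact: L1_sin].
by rewrite !Rintegral_sin_freq addr0 mulr0.
Qed.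

Lemma box_freq_inj N : injective (@box_freq d N).
Proof.
move=> k k' /ffunP kk'; apply/ffunP => i; apply: val_inj.
by have := kk' i; rewrite !ffunE => /addIr [].
Qed.

Lemma sum_box_delta (c : {ffun 'I_d -> int} -> R) l N :
    (forall i, (`|l i| <= N)%N) ->
  \sum_(k : {ffun 'I_d -> 'I_(N.*2.+1)}) c (box_freq k) * (box_freq k == l)%:R
  = c l.
Proof.
move=> lN; pose k0 : {ffun 'I_d -> 'I_(N.*2.+1)} := [ffun i => inord `|l i + N%:Z|].
have k0E : box_freq k0 = l.
  apply/ffunP => i; rewrite !ffunE inordK; last by have := lN i; lia.
  by rewrite gez0_abs ?addrK//; have := lN i; lia.
rewrite (bigD1 k0)//= k0E eqxx mulr1 big1 ?addr0// => k kk0.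
by rewrite -k0E (inj_eq (@box_freq_inj N)) (negbTE kk0) mulr0.
Qed.

Lemma near_box l : \forall N \near \oo, forall i, (`|l i| <= N)%N.
Proof.
exists (\max_i `|l i|%N)%N => // N /= lN i; apply: leq_trans lN.
exact: (leq_bigmax (F := fun i => `|l i|%N)).
Qed.

End orthogonality.

Section heat_properties.
Context {R : realType} {d m : nat}.
Local Notation mu := (lebesgue_Rd R d).
Local Notation T := (torus R d).
Local Notation vol := ((2 * pi) ^+ d : R).
Implicit Types (t : R) (N : nat) (x y : Rd R d) (U : Rd R d -> 'M[R]_m)
  (k l : {ffun 'I_d -> int}).

Let mT : measurable T. Proof. exact: measurable_torus. Qed.
Let finT : (mu T < +oo)%E. Proof. exact: finite_torus. Qed.

Lemma L1_cst (c : R) : L1 mu T (fun=> c).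
Proof. by apply: (L1_bounded mT finT (C := `|c|)) => //; exact: measurable_cst. Qed.

Lemma Rintegral_heat_kernel t x : 0 < t ->
  L1 mu T (heat_kernel t x) /\ \int[mu]_(y in T) heat_kernel t x y = vol.
Proof.
move=> t0; have [IK cK] := L1_mul_heat_kernel x t0 (L1_cst 1).
split; first by move: IK; under eq_fun do rewrite mul1r.
under eq_Rintegral do rewrite -[heat_kernel _ _ _]mul1r.
rewrite -(cvg_lim _ cK)//; apply: cvg_lim => //.
rewrite (_ : (fun N => _) = cst vol); first exact: cvg_cst.
apply/funext => N /=.
transitivity (\sum_(k : {ffun 'I_d -> 'I_(N.*2.+1)})
  \int[mu]_(y in T) (expR (- (t * freq_sqnorm R (box_freq k))) *
    (cos (freq_dot (box_freq k) x) * cos (freq_dot (box_freq k) y) +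
     sin (freq_dot (box_freq k) x) * sin (freq_dot (box_freq k) y)))).
  rewrite -Rintegral_sum//; last first.
    move=> k; apply: L1Z => //; apply: L1D => //; apply: L1Z => //.
      exact: L1_cos.
    exact: L1_sin.
  by apply: eq_Rintegral => y _; rewrite mul1r heat_kernel_partialE.
pose c l : R := expR (- (t * freq_sqnorm R l)) * cos (freq_dot l x) * vol.
transitivity (\sum_(k : {ffun 'I_d -> 'I_(N.*2.+1)}) c (box_freq k) *
  (box_freq k == 0)%:R).
  apply: eq_bigr => k _; have Lc := L1_cos (R := R) (box_freq k).
  have Ls := L1_sin (R := R) (box_freq k).
  rewrite RintegralZl//; last by apply: L1D => //; exact: L1Z.
  rewrite RintegralD//; [|exact: L1Z|exact: L1Z].
  rewrite !RintegralZl// Rintegral_cos_freq Rintegral_sin_freq mulr0 addr0 /c.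
  by case: eqP => _ /=; rewrite ?mulr1 ?mulr0// mulrA.
rewrite sum_box_delta; last by move=> i; rewrite ffunE.
rewrite /c freq_dot0 cos0 mulr1 /freq_sqnorm big1 ?mulr0 ?oppr0 ?expR0 ?mul1r//.
by move=> i _; rewrite ffunE expr0n.
Qed.

(** The null set is required to be negligible inside the torus only, as in an
    essential supremum for the restricted measure. *)
Definition ae_frob_le U (r : R) := exists Z : set (Rd R d),
  [/\ measurable Z, mu (Z `&` T) = 0%E & forall x, ~ Z x -> frob_norm (U x) <= r].

Lemma L1_frob_inner U (A : 'M[R]_m) : L1mx U ->
  L1 mu T (fun y => frob_inner A (U y)).
Proof.
move=> IU; under eq_fun do rewrite frob_innerE.
by apply: L1_sum => // i; apply: L1_sum => // j; apply: L1Z => //; exact: IU.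
Qed.

(** V = heat t U x is an average of U against a probability density; pairing it
    with itself gives |V|^2 <= |V| r. *)
Lemma heat_frob_le t U (r : R) x : 0 < t -> 0 <= r -> L1mx U ->
  ae_frob_le U r -> frob_norm (heat t U x) <= r.
Proof.
move=> t0 r0 IU [Z [mZ Z0 Ur]]; set V := heat t U x.
have [IK KE] := Rintegral_heat_kernel x t0.
have IUK i j : L1 mu T (fun y => U y i j * heat_kernel t x y).
  by have [] := L1_mul_heat_kernel x t0 (IU i j).
have [->|V0] := eqVneq (frob_norm V) 0; first by [].
have Vp : 0 < frob_norm V by rewrite lt_def V0 frob_norm_ge0.
rewrite -(ler_pM2l Vp) -expr2 sqr_frob_norm.
have -> : frob_inner V V =
    vol^-1 * \int[mu]_(y in T) (frob_inner V (U y) * heat_kernel t x y).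
  transitivity (vol^-1 * \sum_i \sum_j \int[mu]_(y in T)
      (V i j * (U y i j * heat_kernel t x y))).
    rewrite frob_innerE mulr_sumr; apply: eq_bigr => i _.
    rewrite mulr_sumr; apply: eq_bigr => j _.
    rewrite RintegralZl//; last exact: IUK.
    by rewrite {2}/V heatE// mulrCA.
  have LVUK i j : L1 mu T (fun y => V i j * (U y i j * heat_kernel t x y)).
    exact: L1Z.
  congr (_ * _); transitivity (\sum_i \int[mu]_(y in T)
      (\sum_j V i j * (U y i j * heat_kernel t x y))).
    by apply: eq_bigr => i _; rewrite -Rintegral_sum// => j; exact: LVUK.
  rewrite -Rintegral_sum//; last by move=> i; exact: L1_sum.
  apply: eq_Rintegral => y _; rewrite frob_innerE mulr_suml.
  apply: eq_bigr => i _; rewrite mulr_suml; apply: eq_bigr => j _.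
  by rewrite mulrA.
rewrite mulrC ler_pdivrMr ?vol_gt0// -KE -RintegralZl//.
have [IVK _] := L1_mul_heat_kernel x t0 (L1_frob_inner V IU).
apply: (Rintegral_le_off_null mT mZ Z0 IVK); first exact: L1Z.
move=> y _ nZy; rewrite ler_wpM2r ?heat_kernel_ge0//.
apply: le_trans (frob_cauchy_schwarz _ _) _.
by rewrite ler_wpM2l ?frob_norm_ge0// Ur.
Qed.

Lemma fourier_cosN U k : fourier_cos U (- k) = fourier_cos U k.
Proof.
apply/matrixP => i j; rewrite !mxE; congr (_ * _); apply: eq_Rintegral => y _.
by rewrite freq_dotN cosN.
Qed.

Lemma fourier_sinN U k : L1mx U -> fourier_sin U (- k) = - fourier_sin U k.
Proof.
move=> IU; apply/matrixP => i j; rewrite !mxE -mulrN; congr (_ * _).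
rewrite -[RHS]mulN1r -RintegralZl//; last exact: L1_mul_sin.
by apply: eq_Rintegral => y _; rewrite freq_dotN sinN; ring.
Qed.

Lemma heat_pairing_cvg t U (h : Rd R d -> R) (C : R) i j : 0 < t -> L1mx U ->
    measurable_fun T h -> (forall x, T x -> `|h x| <= C) ->
  \int[mu]_(x in T) (multiplier_partial (heat_symbol t) U N x i j * h x)
    @[N --> \oo] --> \int[mu]_(x in T) (heat t U x i j * h x).
Proof.
move=> t0 IU mh hC; have [B B0 hB] := heat_partial_bound t0 IU.
have mF N : measurable_fun T
    (fun x => multiplier_partial (heat_symbol t) U N x i j * h x).
  apply: measurable_funM => //.
  exact: measurable_funTS (measurable_multiplier_partial _ _ _ _ _).
have Fh x : T x -> multiplier_partial (heat_symbol t) U N x i j * h x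
    @[N --> \oo] --> heat t U x i j * h x.
  by move=> _; apply: cvgM; [exact: heat_cvg|exact: cvg_cst].
have FB N x : T x ->
    `|multiplier_partial (heat_symbol t) U N x i j * h x| <= B * C.
  by move=> Tx; rewrite normrM ler_pM// hC.
by have [] := Rdominated_convergence mT mF Fh (L1_cst (B * C)) FB.
Qed.

(** The integral of a partial Fourier sum against a trigonometric function is
    eventually constant, by orthogonality. *)
Lemma fourier_heat t U l : 0 < t -> L1mx U ->
  fourier_cos (heat t U) l = heat_symbol t (freq_sqnorm R l) *: fourier_cos U l /\
  fourier_sin (heat t U) l = heat_symbol t (freq_sqnorm R l) *: fourier_sin U l.
Proof.
move=> t0 IU; pose e k := heat_symbol t (freq_sqnorm R k).
have eN k : e (- k) = e k by rewrite /e freq_sqnormN.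
have pairing (h : Rd R d -> R) (w z : {ffun 'I_d -> int} -> R) i j :
    measurable_fun setT h -> (forall x, `|h x| <= 1) ->
    (forall k, \int[mu]_(x in T) (cos (freq_dot k x) * h x) = w k) ->
    (forall k, \int[mu]_(x in T) (sin (freq_dot k x) * h x) = z k) ->
    \sum_(k : {ffun 'I_d -> 'I_(N.*2.+1)})
      (e (box_freq k) * (fourier_cos U (box_freq k) i j * w (box_freq k) +
                         fourier_sin U (box_freq k) i j * z (box_freq k)))
      @[N --> \oo] --> \int[mu]_(x in T) (heat t U x i j * h x).
  move=> mh hb hw hz.
  have := @heat_pairing_cvg t U h 1 i j t0 IU (measurable_funTS mh) (fun x _ => hb x).
  apply: cvg_trans; apply: near_eq_cvg; apply: nearW => N.
  have Lc k : L1 mu T (fun x => cos (freq_dot k x) * h x).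
    by apply: L1_mul_trig => //; exact: L1_cos.
  have Ls k : L1 mu T (fun x => sin (freq_dot k x) * h x).
    by apply: L1_mul_trig => //; exact: L1_sin.
  transitivity (\sum_(k : {ffun 'I_d -> 'I_(N.*2.+1)}) \int[mu]_(x in T)
     (e (box_freq k) *
      (fourier_cos U (box_freq k) i j * (cos (freq_dot (box_freq k) x) * h x) +
       fourier_sin U (box_freq k) i j * (sin (freq_dot (box_freq k) x) * h x)))).
    rewrite -Rintegral_sum//; last first.
      by move=> k; apply: L1Z => //; apply: L1D => //; exact: L1Z.
    apply: eq_Rintegral => x _; rewrite multiplier_partialE mulr_suml.
    by apply: eq_bigr => k _; rewrite /e; ring.
  apply: eq_bigr => k _; rewrite RintegralZl//; last first.
    by apply: L1D => //; exact: L1Z.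
  rewrite RintegralD//; [|exact: L1Z|exact: L1Z].
  rewrite RintegralZl//; last exact: Lc.
  by rewrite RintegralZl ?hw ?hz//; exact: Ls.
have limE (u : nat -> R) (a b : R) : (\forall N \near \oo, u N = a) ->
    u N @[N --> \oo] --> b -> b = a.
  move=> ua ub; rewrite -(cvg_lim _ ub)//; apply: cvg_lim => //.
  by apply: cvg_near_cst.
have vol0 : vol != 0 by rewrite gt_eqF ?vol_gt0.
split; apply/matrixP => i j; rewrite mxE [RHS]mxE.
  have cv := pairing _ _ _ i j (measurable_cos_freq l) (fun x => normr_cos_le1 _)
    (fun k => Rintegral_cos_cos k l) (fun k => Rintegral_sin_cos k l).
  rewrite (limE _ (vol * (e l * fourier_cos U l i j)) _ _ cv).
    by rewrite mulKf.
  near=> N; pose g k := vol / 2 * (e k * fourier_cos U k i j).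
  transitivity (\sum_(k : {ffun 'I_d -> 'I_(N.*2.+1)})
    (g (box_freq k) * (box_freq k == l)%:R +
     g (box_freq k) * (box_freq k == - l)%:R)).
    by apply: eq_bigr => k _; rewrite /g; ring.
  have lN : forall i, (`|l i| <= N)%N by near: N; exact: near_box.
  rewrite big_split/= !sum_box_delta//; last first.
    by move=> i'; rewrite ffunE abszN.
  by rewrite /g eN fourier_cosN; field.
have cv := pairing _ _ _ i j (measurable_sin_freq l) (fun x => normr_sin_le1 _)
    (fun k => etrans (eq_Rintegral _ (fun x _ => mulrC _ _)) (Rintegral_sin_cos l k))
    (fun k => Rintegral_sin_sin k l).
rewrite (limE _ (vol * (e l * fourier_sin U l i j)) _ _ cv).
  by rewrite mulKf.
near=> N; pose g k := vol / 2 * (e k * fourier_sin U k i j).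
transitivity (\sum_(k : {ffun 'I_d -> 'I_(N.*2.+1)})
  (g (box_freq k) * (box_freq k == l)%:R -
   g (box_freq k) * (box_freq k == - l)%:R)).
  by apply: eq_bigr => k _; rewrite /g; ring.
have lN : forall i, (`|l i| <= N)%N by near: N; exact: near_box.
rewrite sumrB !sum_box_delta//; last first.
  by move=> i'; rewrite ffunE abszN.
have -> : g (- l) = - g l.
  by rewrite /g eN fourier_sinN// [in LHS]mxE !mulrN.
by rewrite opprK /g; field.
Unshelve. all: by end_near. Qed.

End heat_properties.

(** * Fourier series of bounded matrix-valued functions *)

Lemma frob_norm_le_entries (R : realType) (m : nat) (A : 'M[R]_m) (C : R) :
  0 <= C -> (forall i j, `|A i j| <= C) -> frob_norm A <= m%:R * C.
Proof.
move=> C0 AC; rewrite -(@ler_pXn2r _ 2)// ?nnegrE ?frob_norm_ge0 ?mulr_ge0//.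
rewrite sqr_frob_norm frob_innerE.
apply: (@le_trans _ _ (\sum_(i < m) \sum_(j < m) C ^+ 2)).
  apply: ler_sum => i _; apply: ler_sum => j _.
  by rewrite -expr2 -real_normK ?num_real// ler_pXn2r ?nnegrE.
have -> : (m%:R * C) ^+ 2 = m%:R * (m%:R * C ^+ 2) by ring.
by rewrite !sumr_const !card_ord !mulr_natl.
Qed.

Section fourier_pairing.
Context {R : realType} {d m : nat}.
Local Notation mu := (lebesgue_Rd R d).
Local Notation T := (torus R d).
Local Notation vol := ((2 * pi) ^+ d : R).
Implicit Types (t : R) (N : nat) (x y : Rd R d) (U F : Rd R d -> 'M[R]_m)
  (k l : {ffun 'I_d -> int}) (A : 'M[R]_m).

Let mT : measurable T. Proof. exact: measurable_torus. Qed.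
Let finT : (mu T < +oo)%E. Proof. exact: finite_torus. Qed.
Let vol_neq0 : vol != 0. Proof. by rewrite gt_eqF ?vol_gt0. Qed.

Definition bounded_mx F := (forall i j, measurable_fun T (fun x => F x i j)) /\
  exists C : R, forall x, T x -> frob_norm (F x) <= C.

Lemma bounded_mxP F (C : R) : (forall i j, measurable_fun T (fun x => F x i j)) ->
  (forall x i j, T x -> `|F x i j| <= C) -> bounded_mx F.
Proof.
move=> mF FC; split=> //; exists (m%:R * Num.max 0 C) => x Tx.
apply: frob_norm_le_entries; first by rewrite le_max lexx.
by move=> i j; rewrite le_max FC// orbT.
Qed.

Lemma bounded_mx_entries F : bounded_mx F ->
  exists C : R, forall x i j, T x -> `|F x i j| <= C.
Proof.
move=> [_ [C FC]]; exists C => x i j Tx.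
by apply: le_trans (FC _ Tx); exact: normr_entry_le_frob.
Qed.

Lemma bounded_L1mx F : bounded_mx F -> L1mx F.
Proof.
move=> bF i j; have [C FC] := bounded_mx_entries bF.
by apply: (L1_bounded mT finT (C := C)) => [|x Tx]; [exact: bF.1|exact: FC].
Qed.

Lemma bounded_mxD F U : bounded_mx F -> bounded_mx U ->
  bounded_mx (fun x => F x + U x).
Proof.
move=> bF bU; have [C FC] := bounded_mx_entries bF.
have [B UB] := bounded_mx_entries bU; apply: (@bounded_mxP _ (C + B)).
  move=> i j; under eq_fun do rewrite mxE.
  by apply: measurable_funD; [exact: bF.1|exact: bU.1].
by move=> x i j Tx; rewrite mxE (le_trans (ler_normD _ _))// lerD ?FC ?UB.
Qed.

Lemma bounded_mxZ (c : R) F : bounded_mx F -> bounded_mx (fun x => c *: F x).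
Proof.
move=> bF; have [C FC] := bounded_mx_entries bF.
apply: (@bounded_mxP _ (`|c| * C)).
  move=> i j; under eq_fun do rewrite mxE.
  by apply: measurable_funM => //; exact: bF.1.
by move=> x i j Tx; rewrite mxE normrM ler_wpM2l ?FC.
Qed.

Lemma bounded_heat t U : 0 < t -> L1mx U -> bounded_mx (heat t U).
Proof.
move=> t0 IU; have [C C0 hC] := heat_bound t0 IU.
apply: (@bounded_mxP _ C) => [i j|x i j _]; last exact: hC.
exact: measurable_funTS (measurable_heat i j t0 IU).
Qed.

Lemma bounded_nonlinear_flow t F : 0 < t -> bounded_mx F ->
  bounded_mx (fun x => nonlinear_flow t (F x)).
Proof.
move=> t0 [mF [C FC]]; split=> [i j|].
  apply: (@measurable_mxcvg_comp _ _ _ T m F (fun A => nonlinear_flow t A i j)) => //.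
  by move=> a A aA; exact: mxcvg_nonlinear_flow.
exists (Num.max (Num.sqrt m%:R) C) => x Tx; apply: nonlinear_flow_le => //.
  by rewrite le_max lexx.
by rewrite le_max FC// orbT.
Qed.

Lemma L1_frob_inner_bounded F U : L1mx F -> bounded_mx U ->
  L1 mu T (fun x => frob_inner (F x) (U x)).
Proof.
move=> IF bU; have [C UC] := bounded_mx_entries bU.
under eq_fun do rewrite frob_innerE.
apply: L1_sum => // i; apply: L1_sum => // j.
apply: (L1_mul_bounded mT (IF i j) (bU.1 i j) (C := C)) => x Tx; exact: UC.
Qed.

Lemma fourier_cosD F U k : L1mx F -> L1mx U ->
  fourier_cos (fun x => F x + U x) k = fourier_cos F k + fourier_cos U k.
Proof.
move=> IF IU; apply/matrixP => i j; rewrite !mxE -mulrDr -RintegralD//.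
- by congr (_ * _); apply: eq_Rintegral => x _; rewrite mxE mulrDl.
- exact: L1_mul_cos.
- exact: L1_mul_cos.
Qed.

Lemma fourier_sinD F U k : L1mx F -> L1mx U ->
  fourier_sin (fun x => F x + U x) k = fourier_sin F k + fourier_sin U k.
Proof.
move=> IF IU; apply/matrixP => i j; rewrite !mxE -mulrDr -RintegralD//.
- by congr (_ * _); apply: eq_Rintegral => x _; rewrite mxE mulrDl.
- exact: L1_mul_sin.
- exact: L1_mul_sin.
Qed.

Lemma fourier_cosZ (c : R) F k : L1mx F ->
  fourier_cos (fun x => c *: F x) k = c *: fourier_cos F k.
Proof.
move=> IF; apply/matrixP => i j; rewrite !mxE [RHS]mulrCA -[in RHS]RintegralZl//.
  by congr (_ * _); apply: eq_Rintegral => x _; rewrite mxE mulrA.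
exact: L1_mul_cos.
Qed.

Lemma fourier_sinZ (c : R) F k : L1mx F ->
  fourier_sin (fun x => c *: F x) k = c *: fourier_sin F k.
Proof.
move=> IF; apply/matrixP => i j; rewrite !mxE [RHS]mulrCA -[in RHS]RintegralZl//.
  by congr (_ * _); apply: eq_Rintegral => x _; rewrite mxE mulrA.
exact: L1_mul_sin.
Qed.

Lemma fourier_cos_lin3 (a b1 b2 b3 : R) F1 F2 F3 k :
    bounded_mx F1 -> bounded_mx F2 -> bounded_mx F3 ->
  fourier_cos (fun x => a *: (b1 *: F1 x + b2 *: F2 x + b3 *: F3 x)) k =
  a *: (b1 *: fourier_cos F1 k + b2 *: fourier_cos F2 k +
        b3 *: fourier_cos F3 k).
Proof.
move=> B1 B2 B3; have bZ (b : R) F : bounded_mx F -> L1mx (fun x => b *: F x).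
  by move=> bF; exact/bounded_L1mx/bounded_mxZ.
have b12 : bounded_mx (fun x => b1 *: F1 x + b2 *: F2 x).
  by apply: bounded_mxD; exact: bounded_mxZ.
rewrite fourier_cosZ; last first.
  by apply: bounded_L1mx; apply: bounded_mxD => //; exact: bounded_mxZ.
rewrite fourier_cosD; [|exact: bounded_L1mx|exact: bZ].
rewrite fourier_cosD; [|exact: bZ..].
by rewrite !fourier_cosZ//; exact: bounded_L1mx.
Qed.

Lemma fourier_sin_lin3 (a b1 b2 b3 : R) F1 F2 F3 k :
    bounded_mx F1 -> bounded_mx F2 -> bounded_mx F3 ->
  fourier_sin (fun x => a *: (b1 *: F1 x + b2 *: F2 x + b3 *: F3 x)) k =
  a *: (b1 *: fourier_sin F1 k + b2 *: fourier_sin F2 k +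
        b3 *: fourier_sin F3 k).
Proof.
move=> B1 B2 B3; have bZ (b : R) F : bounded_mx F -> L1mx (fun x => b *: F x).
  by move=> bF; exact/bounded_L1mx/bounded_mxZ.
have b12 : bounded_mx (fun x => b1 *: F1 x + b2 *: F2 x).
  by apply: bounded_mxD; exact: bounded_mxZ.
rewrite fourier_sinZ; last first.
  by apply: bounded_L1mx; apply: bounded_mxD => //; exact: bounded_mxZ.
rewrite fourier_sinD; [|exact: bounded_L1mx|exact: bZ].
rewrite fourier_sinD; [|exact: bZ..].
by rewrite !fourier_sinZ//; exact: bounded_L1mx.
Qed.

Definition coef_inner F U k : R :=
  frob_inner (fourier_cos F k) (fourier_cos U k) +
  frob_inner (fourier_sin F k) (fourier_sin U k).

Definition box_sum N (c : {ffun 'I_d -> int} -> R) : R :=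
  \sum_(k : {ffun 'I_d -> 'I_(N.*2.+1)}) c (box_freq k).

Lemma Rintegral_frob_inner_trig F A (h : Rd R d -> R) : L1mx F ->
    measurable_fun setT h -> (forall x, `|h x| <= 1) ->
  \int[mu]_(x in T) (frob_inner A (F x) * h x) =
  vol * frob_inner A (\matrix_(i, j) (vol^-1 * \int[mu]_(x in T) (F x i j * h x))).
Proof.
move=> IF mh hb; have LF i j : L1 mu T (fun x => F x i j * h x).
  exact: L1_mul_trig.
transitivity (\sum_i \int[mu]_(x in T) (\sum_j A i j * (F x i j * h x))).
  rewrite -Rintegral_sum//; last first.
    by move=> i; apply: L1_sum => // j; apply: L1Z.
  apply: eq_Rintegral => x _; rewrite frob_innerE mulr_suml.
  apply: eq_bigr => i _; rewrite mulr_suml; apply: eq_bigr => j _.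
  by rewrite mulrA.
rewrite frob_innerE mulr_sumr; apply: eq_bigr => i _.
rewrite Rintegral_sum//; last by move=> j; exact: L1Z.
rewrite mulr_sumr; apply: eq_bigr => j _; rewrite mxE RintegralZl//; last exact: LF.
by rewrite mulrCA mulVKf.
Qed.

(** No orthogonality is involved: the coefficients of the second factor appear
    by linearity. *)
Lemma Rintegral_multiplier_partial (p : R -> R) U F N : L1mx F ->
  L1 mu T (fun x => frob_inner (multiplier_partial p U N x) (F x)) /\
  \int[mu]_(x in T) frob_inner (multiplier_partial p U N x) (F x) =
  vol * box_sum N (fun k => p (freq_sqnorm R k) * coef_inner U F k).
Proof.
move=> IF; pose f k x := p (freq_sqnorm R k) *
  (frob_inner (fourier_cos U k) (F x) * cos (freq_dot k x) +
   frob_inner (fourier_sin U k) (F x) * sin (freq_dot k x)).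
have fE x : frob_inner (multiplier_partial p U N x) (F x) =
    \sum_(k : {ffun 'I_d -> 'I_(N.*2.+1)}) f (box_freq k) x.
  rewrite /frob_inner /multiplier_partial linear_sum/= mulmx_suml.
  rewrite linear_sum/=; apply: eq_bigr => k _; rewrite -/(frob_inner _ _).
  by rewrite frob_innerZl frob_innerDl !frob_innerZl /f; congr (_ * _); ring.
have Lc k : L1 mu T (fun x => frob_inner (fourier_cos U k) (F x) * cos (freq_dot k x)).
  exact/L1_mul_cos/L1_frob_inner.
have Ls k : L1 mu T (fun x => frob_inner (fourier_sin U k) (F x) * sin (freq_dot k x)).
  exact/L1_mul_sin/L1_frob_inner.
have Lf k : L1 mu T (f k) by apply: L1Z => //; exact: L1D.
split; first by under eq_fun do rewrite fE; apply: L1_sum => // k; exact: Lf.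
under eq_Rintegral do rewrite fE.
rewrite Rintegral_sum// mulr_sumr; apply: eq_bigr => k _.
rewrite RintegralZl//; last by apply: L1D; [|exact: Lc|exact: Ls].
rewrite RintegralD//; [|exact: Lc|exact: Ls].
rewrite Rintegral_frob_inner_trig//; last 2 first.
- exact: measurable_cos_freq.
- by move=> x; exact: normr_cos_le1.
rewrite Rintegral_frob_inner_trig//; last 2 first.
- exact: measurable_sin_freq.
- by move=> x; exact: normr_sin_le1.
by rewrite -mulrDr mulrCA.
Qed.

(** Parseval's identity when one factor is in the range of the heat semigroup;
    its Fourier series then converges boundedly to it. *)
Lemma parseval_heat t U F : 0 < t -> L1mx U -> bounded_mx F ->
  vol * box_sum N (coef_inner (heat t U) F) @[N --> \oo] -->
  \int[mu]_(x in T) frob_inner (heat t U x) (F x).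
Proof.
move=> t0 IU bF; have IF := bounded_L1mx bF.
have [C FC] := bounded_mx_entries bF.
have IV := L1mx_heat t0 IU.
rewrite (_ : (fun N => _) = fun N => \sum_i \sum_j \int[mu]_(x in T)
    (multiplier_partial (heat_symbol t) U N x i j * F x i j)).
  have -> : \int[mu]_(x in T) frob_inner (heat t U x) (F x) =
      \sum_i \sum_j \int[mu]_(x in T) (heat t U x i j * F x i j).
    have LV i j : L1 mu T (fun x => heat t U x i j * F x i j).
      by apply: (L1_mul_bounded mT (IV i j) (bF.1 i j) (C := C)) => x Tx; exact: FC.
    transitivity (\sum_i \int[mu]_(x in T) (\sum_j heat t U x i j * F x i j)).
      rewrite -Rintegral_sum//; last by move=> i; exact: L1_sum.
      by apply: eq_Rintegral => x _; rewrite frob_innerE.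
    by apply: eq_bigr => i _; rewrite Rintegral_sum.
  apply: cvg_sumr => i; apply: cvg_sumr => j.
  by apply: (@heat_pairing_cvg _ _ _ _ _ _ C) => // [|x Tx]; [exact: bF.1|exact: FC].
apply/funext => N.
have LP i j : L1 mu T (fun x =>
    multiplier_partial (heat_symbol t) U N x i j * F x i j).
  have [B B0 hB] := heat_partial_bound t0 IU.
  under eq_fun do rewrite mulrC.
  apply: (L1_mul_bounded mT (IF i j) _ (C := B)) => [|x _]; last exact: hB.
  exact: measurable_funTS (measurable_multiplier_partial _ _ _ _ _).
transitivity (\int[mu]_(x in T)
    frob_inner (multiplier_partial (heat_symbol t) U N x) (F x)).
  have [_ ->] := Rintegral_multiplier_partial (heat_symbol t) U N IF.
  congr (_ * _); apply: eq_bigr => k _; rewrite /coef_inner.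
  have [-> ->] := fourier_heat (box_freq k) t0 IU.
  by rewrite !frob_innerZl mulrDr.
transitivity (\sum_i \int[mu]_(x in T)
    (\sum_j multiplier_partial (heat_symbol t) U N x i j * F x i j)).
  rewrite -Rintegral_sum//; last by move=> i; exact: L1_sum.
  by apply: eq_Rintegral => x _; rewrite frob_innerE.
by apply: eq_bigr => i _; rewrite Rintegral_sum.
Qed.

Lemma box_sum_nondecreasing (c : {ffun 'I_d -> int} -> R) N :
  (forall k, 0 <= c k) -> box_sum N c <= box_sum N.+1 c.
Proof.
move=> c0.
(* The index j of a box of size N stands for the frequency j - N, so that
   enlarging the box shifts the indices by one. *)
pose h (q : {ffun 'I_d -> 'I_(N.*2.+1)}) : {ffun 'I_d -> 'I_(N.+1.*2.+1)} :=
  [ffun i => inord (q i).+1].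
have hE q : box_freq (h q) = box_freq q.
  by apply/ffunP => i; rewrite !ffunE inordK; have := ltn_ord (q i); lia.
have h_inj : injective h.
  by move=> q q' qq'; apply: (@box_freq_inj d N); rewrite -!hE qq'.
rewrite /box_sum [leRHS](bigID (mem [set h q' | q' in xpredT]%SET))/=.
rewrite big_imset/=; last by move=> q q' _ _; exact: h_inj.
under [X in _ <= X + _]eq_bigr do rewrite hE.
by rewrite lerDl sumr_ge0.
Qed.

End fourier_pairing.

(** * Dissipation of the modified energy *)

Lemma lim_le_perturbed (R : realType) (f g rho : nat -> R) :
  cvgn (fun N => (f N)%:E) -> cvgn (fun N => (g N)%:E) ->
  rho N @[N --> \oo] --> 0 -> (forall N, f N <= g N + rho N) ->
  (limn (fun N => (f N)%:E) <= limn (fun N => (g N)%:E))%E.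
Proof.
move=> cf cg rho0 fg.
have crho : (rho N)%:E @[N --> \oo] --> 0%E.
  by apply: cvg_EFin; [exact: nearW|exact: rho0].
have cR : ((g N)%:E + (rho N)%:E)%E @[N --> \oo] --> limn (fun N => (g N)%:E).
  rewrite -[X in _ --> X]adde0; apply: cvgeD => //.
  by rewrite fin_num_adde_defl.
rewrite -(cvg_lim _ cR)//; apply: lee_lim => //.
  by apply/cvg_ex; eexists; exact: cR.
by apply: nearW => N; rewrite -EFinD lee_fin; exact: fg.
Qed.

Section energy.
Context {R : realType} {d m : nat}.
Local Notation mu := (lebesgue_Rd R d).
Local Notation T := (torus R d).
Local Notation vol := ((2 * pi) ^+ d : R).
Implicit Types (t tau : R) (N : nat) (U V W F : Rd R d -> 'M[R]_m)
  (k l : {ffun 'I_d -> int}) (A B : 'M[R]_m).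

Let mT : measurable T. Proof. exact: measurable_torus. Qed.
Let finT : (mu T < +oo)%E. Proof. exact: finite_torus. Qed.

Lemma L1_energy_density tau F : 0 < tau -> bounded_mx F ->
  L1 mu T (fun x => frob_inner (G tau (F x)) 1%:M).
Proof.
move=> tau0 [mF [C FC]]; set c := expR (2 * tau) - 1.
have c0 : 0 < c by rewrite subr_gt0 expR_gt1 mulr_gt0.
have mE : measurable_fun T (fun x => frob_inner (G tau (F x)) 1%:M).
  apply: (@measurable_mxcvg_comp _ _ _ T m F
    (fun A => frob_inner (G tau A) 1%:M)) => //.
  move=> a A aA; rewrite frob_inner_G; under eq_fun do rewrite frob_inner_G.
  apply: cvgB; apply: cvgM; try exact: cvg_cst.
    by apply: mxcvg_trace; apply: mxcvg_mul => //; exact: mxcvg_tr.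
  apply: cvgB; last exact: cvg_cst.
  by apply: mxcvg_trace; apply: mxcvg_root_gram => //; exact: ltW.
set k := expR tau / (tau * c).
have k0 : 0 <= k by rewrite divr_ge0 ?expR_ge0// mulr_ge0 ?ltW.
have tau2 : 0 <= (2 * tau)^-1 by rewrite invr_ge0 mulr_ge0// ltW.
apply: (L1_bounded mT finT
  (C := (2 * tau)^-1 * C ^+ 2 + k * (m%:R + c * C ^+ 2))) => // x Tx.
have FC2 : frob_inner (F x) (F x) <= C ^+ 2.
  have Cp : 0 <= C by apply: le_trans (frob_norm_ge0 (F x)) (FC _ Tx).
  by rewrite -sqr_frob_norm ler_pXn2r ?nnegrE ?frob_norm_ge0// FC.
have F0 := frob_inner_ge0 (F x).
have /andP[r0 r1] := trace_root_gram_bound (F x) (ltW c0).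
rewrite frob_inner_G -/c -/k (le_trans (ler_normB _ _))//.
rewrite [X in X + _]normrM [X in _ + X]normrM.
rewrite (ger0_norm tau2) (ger0_norm k0) (ger0_norm F0).
apply: lerD; first exact: ler_wpM2l.
apply: ler_wpM2l => //; rewrite ler_norml; apply/andP; split.
  have : 0 <= c * C ^+ 2 by rewrite mulr_ge0 ?sqr_ge0// ltW.
  lra.
have : c * frob_inner (F x) (F x) <= c * C ^+ 2 by rewrite ler_pM2l.
have := ler0n R m; lra.
Qed.

Definition energy_partial tau V N : R :=
  (2 * tau)^-1 * (vol * box_sum N (fun k =>
    (expR (tau * freq_sqnorm R k) - 1) * coef_inner V V k)) +
  \int[mu]_(x in T) frob_inner (G tau (V x)) 1%:M.

Lemma modified_energyE tau V : 0 < tau -> bounded_mx V ->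
  modified_energy tau V = limn (fun N => (energy_partial tau V N)%:E).
Proof.
move=> tau0 bV; rewrite /modified_energy; congr (limn _); apply/funext => N.
have [Lp Ep] := Rintegral_multiplier_partial
  (fun s => expR (tau * s) - 1) V N (bounded_L1mx bV).
have LG := L1_energy_density tau0 bV.
rewrite /energy_partial -Ep -RintegralZl// -RintegralD//; last exact: L1Z.
rewrite /Rintegral fineK//; apply: integrable_fin_num => //.
by apply: L1D => //; exact: L1Z.
Qed.

Lemma coef_inner_ge0 V k : 0 <= coef_inner V V k.
Proof. by rewrite addr_ge0 ?frob_inner_ge0. Qed.

Lemma energy_partial_cvg tau V : 0 < tau ->
  cvgn (fun N => (energy_partial tau V N)%:E).
Proof.
move=> tau0; apply: ereal_nondecreasing_is_cvgn.
apply/nondecreasing_seqP => N; rewrite lee_fin lerD2r.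
rewrite ler_wpM2l ?invr_ge0 ?mulr_ge0 ?(ltW tau0)// ler_wpM2l ?(ltW vol_gt0)//.
apply: box_sum_nondecreasing => k; rewrite mulr_ge0 ?coef_inner_ge0//.
rewrite subr_ge0 -expR0 ler_expR mulr_ge0 ?(ltW tau0)//.
by apply: sumr_ge0 => i _; rewrite sqr_ge0.
Qed.

(** The mode of frequency k, with lam = e^(tau |k|^2): A and B are the
    coefficients of V and V', and lam B is the one of the nonlinear flow of V.
    The difference of the two sides is lam |A - B|^2 / (2 tau). *)
Lemma dissipation_mode tau (lam : R) A B : 0 < tau -> 0 <= lam ->
  (2 * tau)^-1 * ((lam - 1) * frob_inner B B) <=
  (2 * tau)^-1 * ((lam - 1) * frob_inner A A) +
  (frob_inner B ((2 * tau)^-1 *: (2 *: (lam *: B) + (- 1) *: B + (- 1) *: A)) -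
   frob_inner A ((2 * tau)^-1 *: (2 *: (lam *: B) + (- 1) *: B + (- 1) *: A))).
Proof.
move=> tau0 lam0; have t0 : 0 <= (2 * tau)^-1 by rewrite invr_ge0 mulr_ge0 ?ltW.
have h := mulr_ge0 (mulr_ge0 t0 lam0) (frob_inner_ge0 (A - B)).
rewrite -subr_ge0; apply: le_trans h _; rewrite le_eqVlt; apply/orP; left; apply/eqP.
rewrite !(frob_innerDl, frob_innerDr, frob_innerNl, frob_innerNr,
  frob_innerZl, frob_innerZr) (frob_innerC B A); ring.
Qed.

(** With W for the image of V under the nonlinear flow, this is minus the gradient
    (V - W) / tau at V of the second part of the energy, minus half of the
    increment (V' - V) / tau of the gradient of its quadratic term. *)
Definition test_function tau V V' (x : Rd R d) : 'M[R]_m :=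
  (2 * tau)^-1 *:
    (2 *: nonlinear_flow tau (V x) + (- 1) *: V' x + (- 1) *: V x).

Lemma bounded_test_function tau V V' : 0 < tau -> bounded_mx V ->
  bounded_mx V' -> bounded_mx (test_function tau V V').
Proof.
move=> tau0 bV bV'; apply: bounded_mxZ; apply: bounded_mxD; last exact: bounded_mxZ.
apply: bounded_mxD; last exact: bounded_mxZ.
by apply: bounded_mxZ; exact: bounded_nonlinear_flow.
Qed.

Lemma Rintegral_energy_density_le tau V V' : 0 < tau -> bounded_mx V ->
    bounded_mx V' ->
  \int[mu]_(x in T) frob_inner (G tau (V' x)) 1%:M <=
  \int[mu]_(x in T) frob_inner (G tau (V x)) 1%:M -
  (\int[mu]_(x in T) frob_inner (V' x) (test_function tau V V' x) -
   \int[mu]_(x in T) frob_inner (V x) (test_function tau V V' x)).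
Proof.
move=> tau0 bV bV'; have bF := bounded_test_function tau0 bV bV'.
have LG := L1_energy_density tau0 bV; have LG' := L1_energy_density tau0 bV'.
have LF := L1_frob_inner_bounded (bounded_L1mx bV) bF.
have LF' := L1_frob_inner_bounded (bounded_L1mx bV') bF.
rewrite -(RintegralB mT LF' LF) -(RintegralB mT LG (L1B mT LF' LF)).
apply: le_Rintegral => // [|x Tx]; first by apply: L1B => //; exact: L1B.
apply: le_trans (frob_inner_G_le (V x) (V' x) tau0) _.
rewrite le_eqVlt; apply/orP; left; apply/eqP; rewrite /test_function.
move: (V' x) (V x) (nonlinear_flow _ (V x)) (frob_inner (G _ _) _) => B A W g.
rewrite !(frob_innerDl, frob_innerDr, frob_innerNl, frob_innerNr,
  frob_innerZl, frob_innerZr) (frob_innerC W B) (frob_innerC W A)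
  (frob_innerC A B); ring.
Qed.

(** In each Fourier mode the quadratic part of the energy increases at most by
    the pairing of V' - V with the test function, and the other part decreases
    at least by this pairing; the truncation of the Fourier sums leaves an error
    that tends to 0. *)
Lemma modified_energy_le tau V V' : 0 < tau -> bounded_mx V -> bounded_mx V' ->
    (forall F, bounded_mx F -> vol * box_sum N (coef_inner V F) @[N --> \oo] -->
      \int[mu]_(x in T) frob_inner (V x) (F x)) ->
    (forall F, bounded_mx F -> vol * box_sum N (coef_inner V' F) @[N --> \oo] -->
      \int[mu]_(x in T) frob_inner (V' x) (F x)) ->
    (forall k, fourier_cos (fun x => nonlinear_flow tau (V x)) k =
      expR (tau * freq_sqnorm R k) *: fourier_cos V' k) ->
    (forall k, fourier_sin (fun x => nonlinear_flow tau (V x)) k =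
      expR (tau * freq_sqnorm R k) *: fourier_sin V' k) ->
  (modified_energy tau V' <= modified_energy tau V)%E.
Proof.
move=> tau0 bV bV' pV pV' cW sW.
have bW := bounded_nonlinear_flow tau0 bV.
have bF := bounded_test_function tau0 bV bV'.
have density_le := Rintegral_energy_density_le tau0 bV bV'.
have cF k := fourier_cos_lin3 (2 * tau)^-1 2 (- 1) (- 1) k bW bV' bV.
have sF k := fourier_sin_lin3 (2 * tau)^-1 2 (- 1) (- 1) k bW bV' bV.
rewrite -/(test_function tau V V') in cF sF.
move: (test_function tau V V') bF density_le cF sF => F bF density_le cF sF.
move: density_le (pV F bF) (pV' F bF).
move: (\int[mu]_(x in T) frob_inner (V' x) (F x))
  (\int[mu]_(x in T) frob_inner (V x) (F x)) => r' r density_le cr cr'.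
pose rho N := vol * box_sum N (coef_inner V' F) - vol * box_sum N (coef_inner V F)
  - (r' - r).
have rho0 : rho N @[N --> \oo] --> 0.
  rewrite -(subrr (r' - r)); apply: cvgB; last exact: cvg_cst.
  exact: cvgB.
have step N : energy_partial tau V' N <= energy_partial tau V N + rho N.
  suff h : (2 * tau)^-1 * (vol * box_sum N (fun k =>
        (expR (tau * freq_sqnorm R k) - 1) * coef_inner V' V' k)) <=
      (2 * tau)^-1 * (vol * box_sum N (fun k =>
        (expR (tau * freq_sqnorm R k) - 1) * coef_inner V V k)) +
      (vol * box_sum N (coef_inner V' F) - vol * box_sum N (coef_inner V F)).
    by rewrite /energy_partial addrACA; exact: lerD.
  rewrite -mulrBr !(mulrCA (2 * tau)^-1) -mulrDr ler_wpM2l ?(ltW vol_gt0)//.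
  rewrite /box_sum !mulr_sumr -sumrB -big_split/=; apply: ler_sum => q _.
  rewrite /coef_inner cF sF cW sW; move: (box_freq q) => k.
  have lam0 : 0 <= expR (tau * freq_sqnorm R k) by exact: expR_ge0.
  have hc := dissipation_mode (fourier_cos V k) (fourier_cos V' k) tau0 lam0.
  have hs := dissipation_mode (fourier_sin V k) (fourier_sin V' k) tau0 lam0.
  rewrite !mulrDr opprD [X in _ <= _ + X]addrACA.
  rewrite [leRHS]addrACA.
  by apply: lerD; [exact: hc|exact: hs].
rewrite (modified_energyE tau0 bV) (modified_energyE tau0 bV').
have cE := @energy_partial_cvg tau V tau0.
have cE' := @energy_partial_cvg tau V' tau0.
exact: (lim_le_perturbed cE' cE rho0 step).
Qed.

(** The scheme reads e^{-tau Laplacian} V' = W for V = heat (tau / 2) U and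
    W the image of V under the nonlinear flow. *)
Lemma energy_dissipation tau U : 0 < tau -> L1mx U ->
  (modified_energy tau (heat (tau / 2) (strang_step tau U)) <=
   modified_energy tau (heat (tau / 2) U))%E.
Proof.
move=> tau0 IU; have t0 : 0 < tau / 2 by rewrite divr_gt0.
have bV := bounded_heat t0 IU.
have IW := bounded_L1mx (bounded_nonlinear_flow tau0 bV).
have IhW := L1mx_heat t0 IW.
have symbol2 k : expR (tau * freq_sqnorm R k) *
    heat_symbol (tau / 2) (freq_sqnorm R k) *
    heat_symbol (tau / 2) (freq_sqnorm R k) = 1.
  by rewrite /heat_symbol -!expRD -[RHS]expR0; congr expR; field.
apply: (modified_energy_le tau0 bV (bounded_heat t0 IhW)).
- by move=> F; exact: parseval_heat.
- by move=> F; exact: parseval_heat.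
- move=> k; have [-> _] := fourier_heat k t0 IhW.
  have [-> _] := fourier_heat k t0 IW.
  by rewrite !scalerA symbol2 scale1r.
- move=> k; have [_ ->] := fourier_heat k t0 IhW.
  have [_ ->] := fourier_heat k t0 IW.
  by rewrite !scalerA symbol2 scale1r.
Qed.

End energy.

(** * Maximum principle and conclusion *)

Section maximum_principle.
Context {R : realType} {d m : nat}.
Local Notation mu := (lebesgue_Rd R d).
Local Notation T := (torus R d).
Implicit Types (t tau : R) (U : Rd R d -> 'M[R]_m).

Lemma Linfty_norm_ae U (r : R) : (Linfty_norm U <= r%:E)%E -> ae_frob_le U r.
Proof.
move=> /ess_sup_inf.ess_supP [Z [mZ Z0 UZ]]; exists Z; split => // x nZ.
by rewrite -lee_fin; apply: contrapT => /UZ.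
Qed.

Lemma Linfty_norm_le U (r : R) :
  (forall x, frob_norm (U x) <= r) -> (Linfty_norm U <= r%:E)%E.
Proof.
by move=> Ur; apply/ess_sup_inf.ess_supP; apply: aeW => x; rewrite lee_fin.
Qed.

Lemma L1mx_strang_step tau U : 0 < tau -> L1mx U -> L1mx (strang_step tau U).
Proof.
move=> tau0 IU; have t0 : 0 < tau / 2 by rewrite divr_gt0.
apply: L1mx_heat => //; apply: bounded_L1mx.
by apply: bounded_nonlinear_flow => //; exact: bounded_heat.
Qed.

Lemma L1mx_strang tau U n : 0 < tau -> L1mx U -> L1mx (strang tau U n).
Proof. by move=> tau0 IU; elim: n => [//|n IH]; exact: L1mx_strang_step. Qed.

Lemma strang_step_frob_le tau U (r : R) x : 0 < tau -> L1mx U ->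
  Num.sqrt m%:R <= r -> ae_frob_le U r -> frob_norm (strang_step tau U x) <= r.
Proof.
move=> tau0 IU mr Ur; have t0 : 0 < tau / 2 by rewrite divr_gt0.
have r0 : 0 <= r by apply: le_trans mr; exact: sqrtr_ge0.
have bV := bounded_heat t0 IU.
apply: heat_frob_le => //.
  exact/bounded_L1mx/bounded_nonlinear_flow.
exists set0; split => //; first by rewrite set0I measure0.
by move=> y _; apply: nonlinear_flow_le => //; exact: heat_frob_le.
Qed.

Lemma maximum_principle tau U : 0 < tau -> L1mx U ->
  (Linfty_norm (strang_step tau U) <=
   maxe (Num.sqrt m%:R)%:E (Linfty_norm U))%E.
Proof.
move=> tau0 IU; set L := maxe _ _.
have mL : ((Num.sqrt m%:R)%:E <= L)%E by rewrite le_max lexx.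
have UL : (Linfty_norm U <= L)%E by rewrite le_max lexx orbT.
case: L mL UL => [r| |]; last by rewrite leeNy_eq.
  rewrite lee_fin => mr Ur; apply: Linfty_norm_le => x.
  by apply: strang_step_frob_le => //; exact: Linfty_norm_ae.
by move=> _ _; rewrite leey.
Qed.

Lemma strang_Linfty_le tau U n : 0 < tau -> L1mx U ->
  (Linfty_norm (strang tau U n) <= maxe (Num.sqrt m%:R)%:E (Linfty_norm U))%E.
Proof.
move=> tau0 IU; elim: n => [|n IH]; first by rewrite le_max lexx orbT.
apply: (le_trans (maximum_principle tau0 (L1mx_strang n tau0 IU))).
by rewrite ge_max IH le_max lexx.
Qed.

End maximum_principle.

Theorem theorem1p2 (R : realType) (d m : nat) (hd : (1 <= d <= 3)%N)
    (hm : (1 <= m)%N) (U0 : Rd R d -> 'M[R]_m)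
    (hU0 : forall i j, (lebesgue_Rd R d).-integrable (torus R d)
                         (fun x => (U0 x i j)%:E)) :
  (forall tau : R, 0 < tau ->
    [/\ forall n : nat,
          (Linfty_norm (strang tau U0 n.+1)
             <= maxe (Num.sqrt m%:R)%:E (Linfty_norm (strang tau U0 n)))%E,
        (ereal_sup [set Linfty_norm (strang tau U0 n) | n in [set n | (1 <= n)%N]]
           <= maxe (Num.sqrt m%:R)%:E (Linfty_norm U0))%E
      & (Linfty_norm U0 <= (Num.sqrt m%:R)%:E)%E ->
        (ereal_sup [set Linfty_norm (strang tau U0 n) | n in [set n | (1 <= n)%N]]
           <= (Num.sqrt m%:R)%:E)%E])
  /\
  ((Linfty_norm U0 <= (Num.sqrt m%:R)%:E)%E ->
   forall tau : R, 0 < tau ->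
   m%:R * expR tau * (expR (2 * tau) - 1) <= 43 / 100 ->
   forall n : nat,
     (modified_energy tau (heat (tau / 2) (strang tau U0 n.+1))
        <= modified_energy tau (heat (tau / 2) (strang tau U0 n)))%E).
Proof.
have IU0 : L1mx U0 by exact: hU0.
split=> [tau tau0|_ tau tau0 _ n]; last first.
  exact: energy_dissipation tau0 (L1mx_strang n tau0 IU0).
split=> [n||U0m].
- exact: maximum_principle tau0 (L1mx_strang n tau0 IU0).
- by apply: ge_ereal_sup => _ [n _ <-]; exact: strang_Linfty_le.
- apply: ge_ereal_sup => _ [n _ <-].
  by apply: le_trans (strang_Linfty_le n tau0 IU0) _; rewrite ge_max lexx.
Qed.
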